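(* For every sub-solver $\mathcal{A}$, the parameterized problem SAT($\mathcal{A}$-backdoor) does not admit a polynomial kernel unless $\mathrm{NP} \subseteq \mathrm{coNP}/\mathrm{poly}$.
   Context: For a CNF formula $F$ and a partial truth assignment $\tau$, $F[\tau]$ is obtained by removing satisfied clauses and deleting false literals from the remaining clauses. A sub-solver is an algorithm $\mathcal{A}$ taking a CNF formula $F$ such that: (1) (trichotomy) $\mathcal{A}$ either rejects $F$ or correctly determines $F$ as satisfiable or unsatisfiable; (2) (efficiency) $\mathcal{A}$ runs in polynomial time; (3) (trivial solvability) $\mathcal{A}$ determines $F$ if $F$ has no clauses or contains only the empty clause; (4) (self-reducibility) if $\mathcal{A}$ determines $F$, then for every variable $x$ and $\epsilon\in\{0,1\}$, $\mathcal{A}$ determines $F[x=\epsilon]$. An $\mathcal{A}$-backdoor of $F$ is a set $B$ of variables such that for every truth assignment $\tau$ to $B$, $\mathcal{A}$ determines the satisfiability of $F[\tau]$. SAT($\mathcal{A}$-backdoor): given a CNF formula $F$ and an $\mathcal{A}$-backdoor $B$ of $F$ of size $k$, with parameter $k$, decide whether $F$ is satisfiable. A kernelization for a parameterized problem $P\subseteq\Sigma^*\times\mathbb{N}$ is a polynomial-time algorithm mapping $(x,k)$ to $(x',k')$ with $(x,k)\in P\iff(x',k')\in P$ and $|x'|+k'\le g(k)$ for a computable $g$; it is a polynomial kernel if $g$ is a polynomial. *)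

(* Defs.v *)
From mathcomp Require Import all_boot.
Set Implicit Arguments. Unset Strict Implicit. Unset Printing Implicit Defensive.

(* 1. Machine model: deterministic single-tape Turing machines over    *)
(*    the tape alphabet {0,1,blank} (blank = None), finite state set.  *)

Inductive move := MoveL | MoveR | Stay.

Record TM := {
  tm_n : nat;
  tm_delta : 'I_tm_n.+1 -> option bool -> 'I_tm_n.+1 * option bool * move;
  tm_halt : 'I_tm_n.+1 -> bool }.

(* tape = (cells left of head, reversed; head cell; cells right of head) *)
Definition tape := (seq (option bool) * option bool * seq (option bool))%type.

Definition move_tape (m : move) (t : tape) : tape :=
  let: (l, h, r) := t in
  match m with
  | MoveR => (h :: l, head None r, behead r)
  | MoveL => (behead l, head None l, h :: r)
  | Stay => (l, h, r)
  end.

Definition config (M : TM) := ('I_(tm_n M).+1 * tape)%type.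

Definition step (M : TM) (c : config M) : config M :=
  let: (q, (l, h, r)) := c in
  if @tm_halt M q then c
  else let: (q', s, m) := @tm_delta M q h in (q', move_tape m (l, s, r)).

Definition init (M : TM) (x : seq bool) : config M :=
  (ord0, ([::], head None (map Some x), behead (map Some x))).

Fixpoint read_bits (s : seq (option bool)) : seq bool :=
  match s with
  | Some b :: s' => b :: read_bits s'
  | _ => [::]
  end.

Definition tape_out (t : tape) : seq bool :=
  let: (_, h, r) := t in read_bits (h :: r).

Definition computes_in (M : TM) (f : seq bool -> seq bool) (T : nat -> nat) :=
  forall x, exists t, t <= T (size x) /\
    let c := iter t (@step M) (@init M x) in
    @tm_halt M c.1 /\ tape_out c.2 = f x.

Definition poly_time_computable (f : seq bool -> seq bool) : Prop :=
  exists (M : TM) (c d : nat), computes_in M f (fun n => c * n ^ d + c).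

Definition language := seq bool -> Prop.

Definition poly_time_decidable (L : language) : Prop :=
  exists f, poly_time_computable f /\ forall x, L x <-> f x = [:: true].

Definition double (x : seq bool) : seq bool := flatten [seq [:: b; b] | b <- x].
Definition pairS (x y : seq bool) : seq bool := double x ++ [:: false; true] ++ y.

Definition in_NP (L : language) : Prop :=
  exists (V : language) (c d : nat), poly_time_decidable V /\
    forall x, L x <-> exists w, size w <= c * size x ^ d + c /\ V (pairS x w).

Definition in_coNP (L : language) : Prop := in_NP (fun x => ~ L x).

Definition in_coNP_poly (L : language) : Prop :=
  exists (L' : language) (alpha : nat -> seq bool) (c d : nat),
    in_coNP L' /\ (forall n, size (alpha n) <= c * n ^ d + c) /\
    forall x, L x <-> L' (pairS x (alpha (size x))).

Definition NP_subset_coNP_poly : Prop :=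
  forall L : language, in_NP L -> in_coNP_poly L.

(* literal (v, b): variable v with polarity b (true = positive) *)
Definition literal := (nat * bool)%type.
Definition clause := seq literal.
Definition cnf := seq clause.

Definition passign := nat -> option bool.

Definition lit_true (tau : passign) (l : literal) : bool := tau l.1 == Some l.2.
Definition lit_false (tau : passign) (l : literal) : bool := tau l.1 == Some (~~ l.2).

Definition restrict (F : cnf) (tau : passign) : cnf :=
  [seq [seq l <- C | ~~ lit_false tau l] | C <- F & ~~ has (lit_true tau) C].

Definition single (x : nat) (e : bool) : passign :=
  fun v => if v == x then Some e else None.

Definition satisfiable (F : cnf) : Prop :=
  exists sigma : nat -> bool, all (fun C => has (fun l => sigma l.1 == l.2) C) F.

Fixpoint bits_aux (fuel n : nat) : seq bool :=
  match fuel with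
  | 0 => [::]
  | f.+1 => if n == 0 then [::] else odd n :: bits_aux f n./2
  end.
Definition nat_bits (n : nat) : seq bool := bits_aux n n.  (* LSB first *)

Definition tok0 := [:: false; false; false].
Definition tok1 := [:: false; false; true].
Definition tokSep := [:: false; true; false].
Definition tokEndC := [:: false; true; true].
Definition tokEndF := [:: true; false; false].
Definition tokPos := [:: true; false; true].
Definition tokNeg := [:: true; true; false].

Definition enc_nat (n : nat) : seq bool :=
  flatten [seq (if b then tok1 else tok0) | b <- nat_bits n] ++ tokSep.
Definition enc_lit (l : literal) : seq bool :=
  (if l.2 then tokPos else tokNeg) ++ enc_nat l.1.
Definition enc_clause (C : clause) : seq bool := flatten (map enc_lit C) ++ tokEndC.
Definition enc_cnf (F : cnf) : seq bool := flatten (map enc_clause F) ++ tokEndF.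
Definition enc_vars (B : seq nat) : seq bool := flatten (map enc_nat B) ++ tokEndF.
Definition enc_instance (F : cnf) (B : seq nat) : seq bool := enc_cnf F ++ enc_vars B.

Inductive answer := Reject | Sat | Unsat.

Definition enc_ans (a : answer) : seq bool :=
  match a with Reject => [::] | Sat => [:: true] | Unsat => [:: false] end.

Definition determines (A : cnf -> answer) (F : cnf) : Prop := A F <> Reject.

Definition is_subsolver (A : cnf -> answer) : Prop :=
  (forall F, A F = Sat -> satisfiable F) /\
  (forall F, A F = Unsat -> ~ satisfiable F) /\
  (exists f, poly_time_computable f /\ forall F, f (enc_cnf F) = enc_ans (A F)) /\
  determines A [::] /\
  (forall F, F <> [::] -> all (fun C => C == [::]) F -> determines A F) /\
  (forall F x e, determines A F -> determines A (restrict F (single x e))).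

Definition backdoor (A : cnf -> answer) (F : cnf) (B : seq nat) : Prop :=
  forall tau : passign, (forall v, (tau v != None) = (v \in B)) ->
    determines A (restrict F tau).

Definition param_problem := seq bool -> nat -> Prop.

Definition enc_pk (x : seq bool) (k : nat) : seq bool :=
  double x ++ [:: false; true] ++ nseq k true.

Definition is_kernelization (P : param_problem) (K : seq bool -> nat -> seq bool * nat)
    (g : nat -> nat) : Prop :=
  (exists f, poly_time_computable f /\
     forall x k, f (enc_pk x k) = enc_pk (K x k).1 (K x k).2) /\
  (forall x k, P x k <-> P (K x k).1 (K x k).2) /\
  (forall x k, size (K x k).1 + (K x k).2 <= g k).

Definition has_poly_kernel (P : param_problem) : Prop :=
  exists K (c d : nat), is_kernelization P K (fun k => c * k ^ d + c).

Definition SAT_backdoor (A : cnf -> answer) : param_problem :=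
  fun x k => exists (F : cnf) (B : seq nat),
    x = enc_instance F B /\ uniq B /\ size B = k /\ backdoor A F B /\ satisfiable F.

(* Main.v *)
From HB Require Import structures.
Require Import Defs.
From mathcomp Require Import all_boot zify.
From Stdlib Require Import Classical ClassicalEpsilon.
Set Implicit Arguments. Unset Strict Implicit. Unset Printing Implicit Defensive.

(** Let L be in NP. The Cook-Levin tableau of the verifier gives, for each n, a CNF formula whose
    models, restricted to the variables y_1 .. y_n, are the members of L of length n. Given strings
    X_i of length n indexed by i in {0,1}^l, the clauses "if the selectors spell i then y = X_i"
    turn it into a formula that is satisfiable iff some X_i is in L, and that has poly(n) + l
    variables. Every assignment of all variables leaves only empty clauses, so all variables form
    a backdoor, and the kernel compresses the formula to a string of length m = poly(n + l); l is
    chosen such that 2^l > m although 2^l is polynomial in n.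

    Counting (Fortnow-Santhanam): among any nonempty set N of non-members, some kernel output z is
    produced by families in N that together contain at least half of N. Hence n + 1 outputs, all
    produced by families of non-members, suffice to cover all non-members x: x is not in L iff
    some family containing x is sent into this list Z of outputs.

    By the tableau of the kernelization machine, this condition is again a CNF formula of size
    poly(n) in x and guessed variables. It can be given as advice, since coNP/poly does not ask
    how it is found, so that the only machine to be constructed is one that evaluates CNF
    formulas; these are presented to it as straight-line programs moving a pointer over the guess. *)

Local Notation double := Defs.double.

(** * Polynomially bounded functions *)

Definition polyb (f : nat -> nat) := exists e, forall n, f n <= n.+2 ^ e.

Lemma polyb_le f g : (forall n, f n <= g n) -> polyb g -> polyb f.
Proof. by move=> fg [e he]; exists e => n; apply: leq_trans (fg n) (he n). Qed.

(** The base [n.+2] is at least 2 even at [n = 0], so constants can be absorbed into the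
    exponent. *)
Lemma leq_self_exp c n : c <= n.+2 ^ c.
Proof. exact/ltnW/ltn_expl. Qed.

Lemma polyb_const c : polyb (fun=> c).
Proof. by exists c => n; apply: leq_self_exp. Qed.

Lemma polyb_id : polyb id.
Proof. by exists 1 => n; rewrite expn1; lia. Qed.

Lemma polyb_mul f g : polyb f -> polyb g -> polyb (fun n => f n * g n).
Proof.
by move=> [a fa] [b gb]; exists (a + b) => n; rewrite expnD leq_mul.
Qed.

Lemma polyb_add f g : polyb f -> polyb g -> polyb (fun n => f n + g n).
Proof.
move=> [a fa] [b gb]; exists (a + b).+1 => n; rewrite expnS expnD.
have := fa n; have := gb n; have := expn_gt0 n.+2 a; have := expn_gt0 n.+2 b.
by move: (n.+2 ^ a) (n.+2 ^ b) => A B; nia.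
Qed.

Lemma polyb_S f : polyb f -> polyb (fun n => (f n).+1).
Proof. by move=> pf; apply: polyb_le (polyb_add pf (polyb_const 1)) => n; rewrite addn1. Qed.

Lemma polyb_exp f d : polyb f -> polyb (fun n => f n ^ d).
Proof.
move=> pf; elim: d => [|d IHd]; first exact: polyb_le (polyb_const 1).
by apply: polyb_le (polyb_mul pf IHd) => n; rewrite expnS.
Qed.

Lemma polyb_bound f : polyb f -> exists c d, forall n, f n <= c * n ^ d + c.
Proof.
move=> [e he]; exists (3 ^ e), e => n; apply: leq_trans (he n) _.
case: n => [|n]; first by apply: leq_trans (leq_addl _ _); case: (e) => // a; rewrite leq_exp2r.
rewrite -expnMn (leq_trans _ (leq_addr _ _)) //.
by case: e {he} => // e; rewrite leq_exp2r //; lia.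
Qed.

(** A discrete mean value estimate: the increment of the power from [m] to [m.+1] is at most its
    derivative at [m.+1]. *)
Lemma leq_expS m d : m.+1 ^ d.+1 <= m ^ d.+1 + d.+1 * m.+1 ^ d.
Proof.
elim: d => [|d IHd]; first by rewrite !expn1 expn0; lia.
have h : m ^ d.+1 <= m.+1 ^ d.+1 by rewrite leq_exp2r.
have -> : m.+1 ^ d.+2 = m * m.+1 ^ d.+1 + m.+1 ^ d.+1 by rewrite [LHS]expnS; lia.
have -> : m ^ d.+2 = m * m ^ d.+1 by rewrite expnS.
have e : m * m.+1 ^ d.+1 <= m * m ^ d.+1 + d.+1 * (m * m.+1 ^ d).
  by move: IHd; move: (m.+1 ^ d.+1) (m ^ d.+1) (m.+1 ^ d) => A B C; nia.
have e2 : m * m.+1 ^ d <= m.+1 ^ d.+1 by rewrite expnS leq_mul.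
by move: e e2; move: (m * m.+1 ^ d.+1) (m.+1 ^ d.+1) (m * m ^ d.+1) (m * m.+1 ^ d)=> A B C D; nia.
Qed.

Lemma poly_leq_exp d : exists D, forall m, m ^ d <= D * 2 ^ m.
Proof.
elim: d => [|d [D hD]]; first by exists 1 => m; rewrite mul1n expn_gt0.
(* The increment of [m ^ d.+1] is at most [d.+1 * D * 2 ^ m.+1], which is exactly the increment of
   this constant times [2 ^ m]. *)
exists (2 * (d.+1 * D)); elim=> [|m IHm]; first by rewrite exp0n.
apply: leq_trans (leq_expS _ _) _; have := hD m.+1; rewrite expnS.
by move: IHm; move: (m ^ d.+1) (m.+1 ^ d) (2 ^ m) => A B C; nia.
Qed.

(** The selectors are themselves variables, so the kernel bound that [2 ^ l] must exceed depends on
    [l]. This breaks the circle: with [q] other variables, [l <= q + C] selectors suffice, since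
    there are then at most [2 * q + C] variables in all. *)
Lemma poly_leq_exp_shift c d :
  exists C, forall q, 2 * (c * (2 * q + C) ^ d + c) + 3 <= 2 ^ (q + C).
Proof.
have [D hD] := poly_leq_exp d.+1; pose E := 2 * c * 2 ^ d + 2 * c + 3.
exists (D * E).+1 => q; set m := q + _.
have le : (2 * q + (D * E).+1) ^ d <= 2 ^ d * m ^ d.
  by rewrite -expnMn; case: (d) => // e; rewrite leq_exp2r // /m; lia.
have m1 : 0 < m ^ d by rewrite expn_gt0 /m addnS.
have mE : D * E <= m by rewrite /m; lia.
have := hD m; rewrite expnS => h.
have D0 : 0 < D.
  by rewrite lt0n; apply: contraL h => /eqP ->; rewrite mul0n -ltnNge muln_gt0 m1 /m addnS.
(* From [D * E <= m] follows [D * E * m ^ d <= m ^ d.+1 <= D * 2 ^ m], and [D] cancels. *)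
have h2 : E * m ^ d <= 2 ^ m.
  rewrite -(leq_pmul2l D0); apply: leq_trans h.
  by rewrite mulnA leq_mul.
apply: leq_trans h2; move: le; move: ((2 * q + _) ^ d) => A le.
have := leq_mul (leqnn c) le; have := leq_pmulr c m1; rewrite /E.
move: (2 ^ d) (m ^ d) m1 {le h} => B F F1; rewrite mulnDl [in X in _ -> _ -> _ <= X]mulnDl -!mulnA.
by move: (c * A) (c * (B * F)) (c * F) => X Y Z; lia.
Qed.

(** * Turing machines over an arbitrary finite state type *)

Section FinTM.
Variables (S : finType) (s0 : S).
Variables (delta : S -> option bool -> S * option bool * move) (halt : S -> bool).

(** The initial state of a machine must be [ord0], whereas [s0] can have any rank; so [ord0] is an
    additional name of [s0]. *)
Definition st_dec (q : 'I_#|S|.+1) : S := oapp enum_val s0 (unlift ord0 q).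
Definition st_enc (s : S) : 'I_#|S|.+1 := lift ord0 (enum_rank s).

Lemma st_encK : cancel st_enc st_dec.
Proof. by move=> s; rewrite /st_dec /st_enc liftK /= enum_rankK. Qed.

Definition fin_TM : TM :=
  {| tm_n := #|S|;
     tm_delta := fun q a => let: (s, o, m) := delta (st_dec q) a in (st_enc s, o, m);
     tm_halt := fun q => halt (st_dec q) |}.

Definition fstep (c : S * tape) : S * tape :=
  let: (q, (l, h, r)) := c in
  if halt q then c else let: (q', s, m) := delta q h in (q', move_tape m (l, s, r)).

Definition dec_config (c : config fin_TM) : S * tape := (st_dec c.1, c.2).

Lemma dec_step c : dec_config (@step fin_TM c) = fstep (dec_config c).
Proof.
case: c => q [[l h] r]; rewrite /step /dec_config /= /fstep /=.
by case: ifP => // _; case: (delta _ _) => [[s o] m] /=; rewrite st_encK.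
Qed.

Lemma dec_iter n c : dec_config (iter n (@step fin_TM) c) = iter n fstep (dec_config c).
Proof. by elim: n => //= n IHn; rewrite dec_step IHn. Qed.

Lemma dec_init x :
  dec_config (@init fin_TM x) = (s0, ([::], head None (map Some x), behead (map Some x))).
Proof. by rewrite /dec_config /init /= /st_dec unlift_none. Qed.

End FinTM.

(** * A machine for straight-line pointer programs *)

(** [X1]-[XS] scan the input, each bit of which occurs four times, and erase the separator [1; 1];
    [A1]-[A2] scan the doubled program; [F1]-[F3'] fetch and erase an instruction; [R1] .. [I3]
    execute the instructions that move the head. *)
Inductive ctl :=
  | Start | Mark | X1 | X2 of bool | X3 of bool | X4 of bool | XS | A1 | A2 of bool
  | Back | F1 | F1' | F2 of bool | F2' of bool | F3 of bool & bool | F3' of bool & bool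
  | R1 | R2 | L1 | L2 | I0 | I1 | I2 | I3 | Acc | Halt.

Definition ctl_code (s : ctl) : nat :=
  match s with
  | Start => 0 | Mark => 1 | X1 => 2 | X2 b => 3 + b | X3 b => 5 + b | X4 b => 7 + b
  | XS => 9 | A1 => 10 | A2 b => 11 + b | Back => 13 | F1 => 14 | F1' => 15
  | F2 b => 16 + b | F2' b => 18 + b | F3 b c => 20 + b + c.*2 | F3' b c => 24 + b + c.*2
  | R1 => 28 | R2 => 29 | L1 => 30 | L2 => 31 | I0 => 32 | I1 => 33 | I2 => 34 | I3 => 35
  | Acc => 36 | Halt => 37
  end.

Definition ctl_enum : seq ctl :=
  [:: Start; Mark; X1; X2 false; X2 true; X3 false; X3 true; X4 false; X4 true; XS; A1;
      A2 false; A2 true; Back; F1; F1'; F2 false; F2 true; F2' false; F2' true;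
      F3 false false; F3 true false; F3 false true; F3 true true;
      F3' false false; F3' true false; F3' false true; F3' true true;
      R1; R2; L1; L2; I0; I1; I2; I3; Acc; Halt].

Lemma ctl_codeK : pcancel (fun s => inord (ctl_code s) : 'I_38) (fun i => onth ctl_enum i).
Proof. by move=> s; case: s => *; repeat match goal with b : bool |- _ => case: b end; rewrite inordK. Qed.

HB.instance Definition _ := Finite.copy ctl (pcan_type ctl_codeK).

(** Move the pointer right or left, test the bit at the pointer against a constant or against the
    next input bit (raising the flag on success), require and clear the flag, accept, reject. *)
Inductive instr := IR | IL | IT of bool | II | IE | IA | IX.

Definition decode (b1 b2 b3 : bool) : instr :=
  match b1, b2, b3 with
  | false, false, false => IR | false, false, true => IL
  | false, true, b => IT b
  | true, false, false => II | true, false, true => IE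
  | true, true, false => IA | true, true, true => IX
  end.

(** The components are the control state, the bit at the pointer and the flag. *)
Definition mstate : finType := (ctl * bool * bool)%type.

(** Rejection blanks the head cell, so the output is empty. [IA] blanks a cell and steps left, so
    [Acc] writes its [true] in front of a blank and the output is exactly [[:: true]]. *)
Definition mdelta (q : mstate) (a : option bool) : mstate * option bool * move :=
  let: (s, bit, flag) := q in
  let go s m := ((s, bit, flag), a, m) in
  let del s m := ((s, bit, flag), None, m) in
  let put s b m := ((s, bit, flag), Some b, m) in
  let rej := ((Halt, bit, flag), None, Stay) in
  match s, a with
  | Start, _ => go Mark MoveL
  | Mark, _ => put X1 true MoveR
  | X1, Some b => go (X2 b) MoveR
  | X2 b, Some c => if c == b then go (X3 b) MoveR else rej
  | X3 b, Some c => if c == b then go (X4 b) MoveR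
                    else if c then del XS MoveR else rej
  | X4 b, Some c => if c == b then go X1 MoveR else rej
  | XS, Some c => if c then del A1 MoveR else rej
  | A1, Some b => go (A2 b) MoveR
  | A2 b, Some c => if c == b then go A1 MoveR
                    else if c then ((Back, true, false), None, MoveL) else rej
  | Back, Some _ => go Back MoveL
  | Back, None => go F1 MoveR
  | F1, Some _ => del F1' MoveR
  | F1', Some b => del (F2 b) MoveR
  | F2 b, Some _ => del (F2' b) MoveR
  | F2' b, Some c => del (F3 b c) MoveR
  | F3 b c, Some _ => del (F3' b c) MoveR
  | F3' b c, Some d =>
      match decode b c d with
      | IR => del R1 MoveR
      | IL => del L1 MoveR
      | IT e => ((F1, bit, flag || (bit == e)), None, MoveR)
      | II => del I0 MoveR
      | IE => if flag then ((F1, bit, false), None, MoveR) else rej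
      | IA => del Acc MoveL
      | IX => rej
      end
  | R1, Some _ => go R1 MoveR
  | R1, None => put R2 bit MoveR
  | R2, _ => ((Back, a == Some true, flag), None, MoveL)
  | L1, Some _ => go L1 MoveR
  | L1, None => put L2 bit MoveL
  | L2, Some b => ((Back, b, flag), None, MoveL)
  | I0, Some _ => go I1 MoveL
  | I1, None => go I1 MoveL
  | I1, Some _ => del I2 MoveL
  | I2, Some b => ((I3, bit, flag || (bit == b)), None, MoveR)
  | I3, None => go I3 MoveR
  | I3, Some _ => go F1 Stay
  | Acc, _ => put Halt true Stay
  | _, _ => rej
  end.

Definition mhalt (q : mstate) : bool := if q.1.1 is Halt then true else false.
Definition mstart : mstate := (Start, false, false).

Notation mstep := (fstep mdelta mhalt).

Definition conf (q : mstate) (l s : seq (option bool)) : mstate * tape :=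
  (q, (l, head None s, behead s)).

Definition evalTM := fin_TM mstart mdelta mhalt.

Definition sm := map (@Some bool).

(** Configurations at [F1]. From left to right the tape holds a sentinel and the input bits not
    yet compared ([xs], nearest bit first), erased cells ([gap] + 1), the rest of the program
    followed by the part of the guess left of the pointer ([ys]), a blank at the pointer, whose bit
    [cur] is kept in the state, and the remaining guess ([zs]). Consuming the program from the left
    and the input from the right leaves a single gap between them. *)
Record ast := Ast { xs : seq bool; gap : nat; ys : seq bool; cur : bool; zs : seq bool; flg : bool }.

Definition aconf (a : ast) : mstate * tape :=
  conf (F1, cur a, flg a) (nseq (gap a).+1 None ++ sm (xs a)) (sm (ys a) ++ None :: sm (zs a)).

Definition exec_op (op : instr) (a : ast) : ast + bool :=
  let: Ast xs g ys cur zs flg := a in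
  match op with
  | IR => inl (Ast xs g (rcons ys cur) (head false zs) (behead zs) flg)
  | IL => if ys is y :: ys1 then inl (Ast xs g (belast y ys1) (last y ys1) (cur :: zs) flg)
          else inr false
  | IT e => inl (Ast xs g ys cur zs (flg || (cur == e)))
  | II => if (ys, xs) is (_ :: _, _ :: x :: xs') then
            inl (Ast xs' g.+2 ys cur zs (flg || (cur == x)))
          else inr false
  | IE => if flg then inl (Ast xs g ys cur zs false) else inr false
  | IA => inr true
  | IX => inr false
  end.

Definition exec1 (a : ast) : ast + bool :=
  let: Ast xs g ys cur zs flg := a in
  if ys is _ :: b :: _ :: c :: _ :: d :: ys' then
    exec_op (decode b c d) (Ast xs (g + 6) ys' cur zs flg)
  else inr false.

Arguments exec_op : simpl never.

(** * Simulation of instructions by the machine *)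

Lemma run_back bit flag (zr : seq bool) l s :
  iter (size zr) mstep
    (conf (Back, bit, flag) (behead (sm zr ++ None :: l)) (head None (sm zr ++ None :: l) :: s))
  = conf (Back, bit, flag) l (None :: sm (rev zr) ++ s).
Proof.
elim: zr s => [|b zr IHz] s //; rewrite [size _]/= iterSr.
have -> : mstep (conf (Back, bit, flag) (behead (sm (b :: zr) ++ None :: l))
    (head None (sm (b :: zr) ++ None :: l) :: s)) =
  conf (Back, bit, flag) (behead (sm zr ++ None :: l)) (head None (sm zr ++ None :: l) :: Some b :: s).
  by [].
by rewrite IHz rev_cons /sm map_rcons -cats1 -catA.
Qed.

Lemma run_R1 bit flag (ys : seq bool) l s :
  iter (size ys) mstep (conf (R1, bit, flag) l (sm ys ++ s))
  = conf (R1, bit, flag) (sm (rev ys) ++ l) s.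
Proof.
elim: ys l => [|b ys IHy] l //; rewrite [size _]/= iterSr.
have -> : mstep (conf (R1, bit, flag) l (sm (b :: ys) ++ s)) =
  conf (R1, bit, flag) (Some b :: l) (sm ys ++ s) by [].
by rewrite IHy rev_cons /sm map_rcons -cats1 -catA.
Qed.

Lemma run_L1 bit flag (ys : seq bool) l s :
  iter (size ys) mstep (conf (L1, bit, flag) l (sm ys ++ s))
  = conf (L1, bit, flag) (sm (rev ys) ++ l) s.
Proof.
elim: ys l => [|b ys IHy] l //; rewrite [size _]/= iterSr.
have -> : mstep (conf (L1, bit, flag) l (sm (b :: ys) ++ s)) =
  conf (L1, bit, flag) (Some b :: l) (sm ys ++ s) by [].
by rewrite IHy rev_cons /sm map_rcons -cats1 -catA.
Qed.

Lemma run_I1 bit flag g (xs : seq bool) s :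
  iter g mstep (conf (I1, bit, flag) (behead (nseq g None ++ sm xs))
     (head None (nseq g None ++ sm xs) :: s))
  = conf (I1, bit, flag) (behead (sm xs)) (head None (sm xs) :: nseq g None ++ s).
Proof.
elim: g s => [|g IHg] s //; rewrite iterSr.
have -> : mstep (conf (I1, bit, flag) (behead (nseq g.+1 None ++ sm xs))
    (head None (nseq g.+1 None ++ sm xs) :: s)) =
  conf (I1, bit, flag) (behead (nseq g None ++ sm xs)) (head None (nseq g None ++ sm xs) :: None :: s).
  by [].
by rewrite IHg -[None :: s]cat1s catA -(nseqD g 1) addn1.
Qed.

Lemma run_I3 bit flag g l s :
  iter g mstep (conf (I3, bit, flag) l (nseq g None ++ s))
  = conf (I3, bit, flag) (nseq g None ++ l) s.
Proof.
elim: g l => [|g IHg] l //; rewrite iterSr.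
have -> : mstep (conf (I3, bit, flag) l (nseq g.+1 None ++ s)) =
  conf (I3, bit, flag) (None :: l) (nseq g None ++ s) by [].
by rewrite IHg -[None :: l]cat1s catA -(nseqD g 1) addn1.
Qed.

Definition halts_in (n : nat) (c : mstate * tape) (b : bool) :=
  exists t, t <= n /\ let c' := iter t mstep c in
    mhalt c'.1 /\ tape_out c'.2 = if b then [:: true] else [::].

Definition reaches (n : nat) (c c' : mstate * tape) := exists t, t <= n /\ iter t mstep c = c'.

Lemma reaches_trans n m c1 c2 c3 : reaches n c1 c2 -> reaches m c2 c3 -> reaches (n + m) c1 c3.
Proof. by move=> [t [ht h]] [u [hu h']]; exists (u + t); rewrite iterD h h'; split=> //; lia. Qed.

Lemma reaches_halts n m c1 c2 b : reaches n c1 c2 -> halts_in m c2 b -> halts_in (n + m) c1 b.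
Proof. by move=> [t [ht h]] [u [hu h']]; exists (u + t); rewrite iterD h; split=> //; lia. Qed.

Lemma reaches_le n m c c' : reaches n c c' -> n <= m -> reaches m c c'.
Proof. by move=> [t [ht h]] nm; exists t; split=> //; apply: leq_trans nm. Qed.

Lemma halts_le n m c b : halts_in n c b -> n <= m -> halts_in m c b.
Proof. by move=> [t [ht h]] nm; exists t; split=> //; apply: leq_trans nm. Qed.

(** Common ending of the instructions that move the pointer: walk back over [ys] to the gap and step
    onto the next instruction. *)
Lemma run_return bit flag g xs ys zs :
  reaches (size ys).+1
   (conf (Back, bit, flag) (behead (sm (rev ys) ++ nseq g.+1 None ++ sm xs))
     (head None (sm (rev ys) ++ nseq g.+1 None ++ sm xs) :: None :: sm zs))
   (aconf (Ast xs g ys bit zs flag)).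
Proof. by exists (size ys).+1; rewrite iterS -size_rev run_back revK. Qed.

Definition cost_op (a : ast) := 30 + 2 * (gap a + size (ys a)).

Lemma step_reaches c c' : mstep c = c' -> reaches 1 c c'.
Proof. by exists 1. Qed.

(** Oddness keeps [xs] nonempty, so that the leftward scan [I1] over erased cells meets a nonblank
    cell. It is preserved because bits are consumed in pairs and the sentinel is a single cell. *)
Lemma run_op bit flag b c d g xs ys zs : odd (size xs) ->
  let C := conf (F3' b c, bit, flag) (nseq g None ++ sm xs) (Some d :: sm ys ++ None :: sm zs) in
  let a := Ast xs g ys bit zs flag in
  match exec_op (decode b c d) a with
  | inl a' => reaches (cost_op a) C (aconf a')
  | inr r => halts_in (cost_op a) C r
  end.
Proof.
move=> oxs /=; rewrite /cost_op /=.
set l := nseq g None ++ sm xs; set s := sm ys ++ None :: sm zs.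
case: b; case: c; case: d; rewrite /exec_op /=.
- by exists 1.
- by exists 2.
- case: flag; last by exists 1.
  by apply: (@reaches_le 1); [exact: step_reaches | lia].
- case: ys @s => [|y ys] s; first by exists 2.
  have pop : reaches (g + 3) (conf (F3' true false, bit, flag) l (Some false :: s))
      (conf (I1, bit, flag) (behead (sm xs)) (head None (sm xs) :: nseq g.+1 None ++ s)).
    by exists (g.+1 + 2); split; [lia | rewrite iterD -run_I1].
  case: xs oxs l pop => [|x [|x' xs]] //= _ l pop.
    by apply: (@halts_le (g + 3 + 2)); [apply: reaches_halts pop _; exists 2 | lia].
  have back : reaches (g + 6)
      (conf (I1, bit, flag) (Some x' :: sm xs) (Some x :: nseq g.+1 None ++ s))
      (aconf (Ast xs g.+2 (y :: ys) bit zs (flag || (bit == x')))).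
    exists (1 + (g.+2 + 2)); split; first by lia.
    rewrite iterD iterD.
    have -> : iter 2 mstep (conf (I1, bit, flag) (Some x' :: sm xs) (Some x :: nseq g.+1 None ++ s)) =
      conf (I3, bit, flag || (bit == x')) (None :: sm xs) (nseq g.+2 None ++ s) by [].
    rewrite run_I3 /aconf /= -[None :: sm xs]cat1s.
    by rewrite -[[:: None]]/(nseq 1 None) catA -nseqD addn1.
  by apply: reaches_le (reaches_trans pop back) _; lia.
- by apply: (@reaches_le 1); [exact: step_reaches | lia].
- by apply: (@reaches_le 1); [exact: step_reaches | lia].
- case: ys @s => [|y ys] s; first by exists 3.
  have toptr : reaches ((size ys).+1 + 1) (conf (F3' false false, bit, flag) l (Some true :: s))
      (conf (L1, bit, flag) (sm (rev (y :: ys)) ++ None :: l) (None :: sm zs)).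
    by exists ((size (y :: ys)) + 1); rewrite iterD -run_L1.
  have back : reaches 2 (conf (L1, bit, flag) (sm (rev (y :: ys)) ++ None :: l) (None :: sm zs))
      (conf (Back, last y ys, flag) (behead (sm (rev (belast y ys)) ++ nseq g.+1 None ++ sm xs))
       (head None (sm (rev (belast y ys)) ++ nseq g.+1 None ++ sm xs) :: None :: sm (bit :: zs))).
    by exists 2; rewrite lastI rev_rcons.
  have := reaches_trans (reaches_trans toptr back) (run_return _ _ _ _ _ _).
  by move/reaches_le; apply; rewrite size_belast /=; lia.
- have toptr : reaches (size ys + 1) (conf (F3' false false, bit, flag) l (Some false :: s))
      (conf (R1, bit, flag) (sm (rev ys) ++ None :: l) (None :: sm zs)).
    by exists (size ys + 1); rewrite iterD -run_R1.
  have back : reaches 2 (conf (R1, bit, flag) (sm (rev ys) ++ None :: l) (None :: sm zs))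
      (conf (Back, head false zs, flag) (behead (sm (rev (rcons ys bit)) ++ nseq g.+1 None ++ sm xs))
       (head None (sm (rev (rcons ys bit)) ++ nseq g.+1 None ++ sm xs) :: None :: sm (behead zs))).
    by exists 2; rewrite rev_rcons; case: (zs) => [|[] ?].
  have := reaches_trans (reaches_trans toptr back) (run_return _ _ _ _ _ _).
  by move/reaches_le; apply; rewrite size_rcons; lia.
Qed.

Definition cost (a : ast) := 50 + 2 * (gap a + size (ys a)).

Lemma run_exec1 a : odd (size (xs a)) ->
  match exec1 a with
  | inl a' => reaches (cost a) (aconf a) (aconf a')
  | inr b => halts_in (cost a) (aconf a) b
  end.
Proof.
case: a => xs g ys bit zs flag /= oxs; rewrite /cost /=.
case: ys => [|b1 [|b [|b2 [|c [|b3 [|d ys]]]]]] /=; try by [exists 1|exists 2|exists 3|exists 4|exists 5|exists 6].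
have fetch : reaches 5
    (aconf (Ast xs g [:: b1, b, b2, c, b3, d & ys] bit zs flag))
    (conf (F3' b c, bit, flag) (nseq (g + 6) None ++ sm xs) (Some d :: sm ys ++ None :: sm zs)).
  by exists 5; rewrite addnC.
have := run_op bit flag b c d (g + 6) ys zs oxs; rewrite /cost_op /=.
case: (exec_op _ _) => [a|r] h.
  by apply: reaches_le (reaches_trans fetch h) _; lia.
by apply: halts_le (reaches_halts fetch h) _; lia.
Qed.

Fixpoint exec (n : nat) (a : ast) : bool :=
  if n is n'.+1 then match exec1 a with inl a' => exec n' a' | inr b => b end else false.

(** An instruction removes six cells from [ys] and returns at most one, so the length of [ys] bounds
    the number of steps. *)
Definition accepts (a : ast) : bool := exec (size (ys a)).+1 a.

Lemma exec_op_inv op a a' : exec_op op a = inl a' ->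
  [/\ size (ys a') <= (size (ys a)).+1, gap a' <= (gap a).+2 & odd (size (xs a')) = odd (size (xs a))].
Proof.
case: a => xs g ys bit zs flag; rewrite /exec_op.
case: op => [||e||||] //=.
- by case=> <- /=; rewrite size_rcons; split; lia.
- by case: ys => //= y ys [<-] /=; rewrite size_belast; split; lia.
- by case=> <- /=; split; lia.
- by case: ys xs => [|y ys] [|x [|x' xs]] //= [<-] /=; rewrite negbK; split; lia.
- by case: flag => // -[<-] /=; split; lia.
Qed.

Lemma exec1_inv a a' : exec1 a = inl a' ->
  [/\ size (ys a') < size (ys a), gap a' <= gap a + 8 & odd (size (xs a')) = odd (size (xs a))].
Proof.
case: a => xs g ys bit zs flag /=.
case: ys => [|b1 [|b [|b2 [|c [|b3 [|d ys]]]]]] //= /exec_op_inv [/= h1 h2 h3].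
by split=> //; lia.
Qed.

Lemma exec_fuel n a : size (ys a) < n -> exec n a = accepts a.
Proof.
suff H m : m <= n -> size (ys a) < m -> exec n a = exec m a by move=> h; apply: H.
elim: n m a => [|n IHn] [|m] // a mn am /=.
by case e: (exec1 a) => [a1|//]; have [h _ _] := exec1_inv e; apply: IHn; lia.
Qed.

Lemma accepts_eq a : accepts a = match exec1 a with inl a' => accepts a' | inr b => b end.
Proof.
rewrite {1}/accepts /=; case e: (exec1 a) => [a'|//].
by have [h _ _] := exec1_inv e; apply: exec_fuel.
Qed.

(** Each instruction shortens [ys] and lengthens the gap by at most 8, so [gap] never exceeds its
    initial value by more than [8 * size (ys a)]. This gives the factor [18 = 2 * 8 + 2] in the cost
    of one instruction. *)
Lemma run_accepts a : odd (size (xs a)) ->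
  halts_in ((size (ys a)).+1 * (50 + 2 * gap a + 18 * size (ys a))) (aconf a) (accepts a).
Proof.
have [n] := ubnP (size (ys a)); elim: n a => // n IHn a an oa.
rewrite accepts_eq; have := run_exec1 oa; case e: (exec1 a) => [a'|b]; rewrite /cost => h.
  have [h1 h2 h3] := exec1_inv e.
  have h' := IHn a' ltac:(lia) (etrans h3 oa).
  by apply: halts_le (reaches_halts h h') _; nia.
by apply: halts_le h _; nia.
Qed.

(** * Parsing the nested pair *)

Fixpoint parse_x (acc l : seq bool) : option (seq bool * seq bool) :=
  if l is b1 :: b2 :: b3 :: b4 :: l' then
    if b2 == b1 then
      if b3 == b2 then
        if b4 == b3 then parse_x [:: b4, b3, b2, b1 & acc] l' else None
      else if b3 && b4 then Some ([:: b2, b1 & acc], l') else None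
    else None
  else None.

Fixpoint parse_a (acc l : seq bool) : option (seq bool * seq bool) :=
  if l is b1 :: b2 :: l' then
    if b2 == b1 then parse_a [:: b2, b1 & acc] l'
    else if b2 then Some (rev (b1 :: acc), l') else None
  else None.

(** In [pairS (pairS x a) w] the bits of [x] occur four times, the inner separator reads 0011, [a]
    is doubled and 01 precedes [w]. The initial [true] is the sentinel. Erasing 11 makes two blanks,
    that is, [gap] 1; the last separator bit becomes the pointer cell. *)
Definition run_spec (z : seq bool) : bool :=
  if parse_x [:: true] z is Some (xs, l) then
    if parse_a [::] l is Some (ys, zs) then accepts (Ast xs 1 ys true zs false) else false
  else false.

Lemma run_x acc l :
  match parse_x acc l with
  | Some (xs, l') =>
      reaches (size l) (conf (X1, false, false) (sm acc) (sm l))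
        (conf (A1, false, false) ([:: None, None & sm xs]) (sm l')) /\
      (odd (size xs) = odd (size acc) /\ size l' <= size l)
  | None => halts_in (size l + 5) (conf (X1, false, false) (sm acc) (sm l)) false
  end.
Proof.
have [n] := ubnP (size l); elim: n acc l => // n IHn acc.
move=> [|b1 [|b2 [|b3 [|b4 l]]]] //= ln; try by [exists 1|exists 2|exists 3|exists 4].
- by case: b1 b2 ln => [] [] _; [exists 3|exists 2|exists 2|exists 3].
- by case: b1 b2 b3 ln => [] [] [] _; [exists 4|exists 3|exists 2|exists 2|exists 2|exists 2|exists 4|exists 4].
case: (eqVneq b2 b1) => [->|ne]; last first.
  by exists 2; case: b1 b2 ne {ln} => [] [].
case: (eqVneq b3 b1) => [->|ne]; last first.
  case: b1 b3 ne ln => [] [] //= _ ln; first by exists 3.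
  case: b4 ln => ln.
    by split; [exists 4 | rewrite /= negbK; split; lia].
  by exists 4.
case: (eqVneq b4 b1) => [->|ne]; last first.
  by exists 4; case: b1 b4 ne {ln} => [] [].
have first4 : reaches 4 (conf (X1, false, false) (sm acc) (sm [:: b1, b1, b1, b1 & l]))
   (conf (X1, false, false) (sm [:: b1, b1, b1, b1 & acc]) (sm l)).
  by exists 4; case: b1 {ln}.
have {IHn} := IHn [:: b1, b1, b1, b1 & acc] l; case: (parse_x _ _) => [[xs l']|] IHn.
  have [|h [h1 h2]] := IHn; first by lia.
  split; first exact: reaches_trans first4 h.
  by rewrite h1 /= !negbK; split=> //; lia.
apply: halts_le (reaches_halts first4 (IHn _)) _; lia.
Qed.

Lemma run_a xs acc l :
  match parse_a acc l with
  | Some (ys, zs) =>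
      reaches (2 * size l + size acc + 2) (conf (A1, false, false) (sm acc ++ [:: None, None & sm xs]) (sm l))
        (aconf (Ast xs 1 ys true zs false)) /\ size ys <= size l + size acc
  | None => halts_in (size l + 5) (conf (A1, false, false) (sm acc ++ [:: None, None & sm xs]) (sm l)) false
  end.
Proof.
have [n] := ubnP (size l); elim: n acc l => // n IHn acc.
move=> [|b1 [|b2 l]] //= ln; try by [exists 1|exists 2].
case: (eqVneq b2 b1) => [->|ne].
  have first2 : reaches 2 (conf (A1, false, false) (sm acc ++ [:: None, None & sm xs]) (sm [:: b1, b1 & l]))
    (conf (A1, false, false) (sm [:: b1, b1 & acc] ++ [:: None, None & sm xs]) (sm l)).
    by exists 2; case: b1 {ln}.
  have {IHn} := IHn [:: b1, b1 & acc] l; case: (parse_a _ _) => [[ys zs]|] IHn.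
    have [|h h1] := IHn; first by lia.
    split; last by move: h1 => /=; lia.
    by apply: reaches_le (reaches_trans first2 h) _; rewrite /=; lia.
  apply: halts_le (reaches_halts first2 (IHn _)) _; lia.
case: b1 b2 ne ln => [] [] //= _ ln; first by exists 2.
split; last by rewrite size_rev /=; lia.
have turn : reaches 2 (conf (A1, false, false) (sm acc ++ [:: None, None & sm xs]) (sm [:: false, true & l]))
  (conf (Back, true, false) (behead (sm (rev (rev (false :: acc))) ++ nseq 2 None ++ sm xs))
     (head None (sm (rev (rev (false :: acc))) ++ nseq 2 None ++ sm xs) :: None :: sm l)).
  by exists 2; rewrite revK.
by apply: reaches_le (reaches_trans turn (run_return _ _ _ _ _ _)) _; rewrite size_rev /=; lia.
Qed.

Lemma run_machine z :
  halts_in (100 * size z ^ 2 + 200)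
    (mstart, ([::], head None (sm z), behead (sm z))) (run_spec z).
Proof.
have start : reaches 2 (mstart, ([::], head None (sm z), behead (sm z))) 
    (conf (X1, false, false) (sm [:: true]) (sm z)).
  by exists 2; case: z.
rewrite /run_spec; have := run_x [:: true] z; case: (parse_x _ _) => [[xs l]|] h; last first.
  by apply: halts_le (reaches_halts start h) _; nia.
have [h1 [oxs lz]] := h; have := run_a xs [::] l; case: (parse_a _ _) => [[ys zs]|] h2; last first.
  by apply: halts_le (reaches_halts start (reaches_halts h1 h2)) _; nia.
have [h3 yl] := h2.
apply: halts_le (reaches_halts start (reaches_halts h1 (reaches_halts h3 (run_accepts _)))) _.
  by rewrite /= oxs.
rewrite /= addn0 in yl *; have yz : size ys <= size z by apply: leq_trans yl lz.
have : (size ys).+1 * (50 + 2 * 1 + 18 * size ys) <= (size z).+1 * (50 + 2 * 1 + 18 * size z).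
  by apply: leq_mul; lia.
move: lz; rewrite -mulnn; move: (_.+1 * _) (size l) (size z) => A L N; nia.
Qed.

Lemma run_spec_decidable : poly_time_decidable run_spec.
Proof.
exists (fun z => if run_spec z then [:: true] else [::]); split; last by move=> z; case: ifP.
exists evalTM, 200, 2 => z; have [t [ht [h1 h2]]] := run_machine z.
exists t; split; first by lia.
have e := @dec_iter _ mstart mdelta mhalt t (@init evalTM z); rewrite dec_init in e.
by rewrite -e in h1 h2.
Qed.

(** * Compiling formulas into pointer programs *)

Definition enc_instr (i : instr) : seq bool :=
  match i with
  | IR => [:: false; false; false] | IL => [:: false; false; true]
  | IT b => [:: false; true; b]
  | II => [:: true; false; false] | IE => [:: true; false; true]
  | IA => [:: true; true; false] | IX => [:: true; true; true]
  end.

Definition enc_prog (p : seq instr) : seq bool := flatten (map enc_instr p).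

Lemma size_double s : size (double s) = 2 * size s.
Proof. by elim: s => //= b s; rewrite /double /= => ->; rewrite mulnS. Qed.

Lemma size_enc_prog p : size (enc_prog p) = 3 * size p.
Proof.
elim: p => //= i p; rewrite /enc_prog /= size_cat => ->.
by rewrite mulnS; congr (_ + _); case: i.
Qed.

Definition quad (x : seq bool) : seq bool := flatten [seq [:: b; b; b; b] | b <- x].

Lemma parse_x_pair acc x s t :
  parse_x acc (double (double x ++ [:: false; true] ++ s) ++ t) =
  Some ([:: false, false & quad (rev x) ++ acc], double s ++ t).
Proof.
elim: x acc => [|b x IHx] acc //.
have -> : double (double (b :: x) ++ [:: false; true] ++ s) ++ t =
  [:: b, b, b, b & double (double x ++ [:: false; true] ++ s) ++ t] by [].
rewrite /= !eqxx IHx; congr (Some ([:: _, _ & _], _)).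
by rewrite rev_cons /quad map_rcons flatten_rcons -catA.
Qed.

Lemma parse_a_double acc s t :
  parse_a acc (double s ++ [:: false; true] ++ t) = Some (rev acc ++ double s ++ [:: false], t).
Proof.
elim: s acc => [|b s IHs] acc /=; first by rewrite rev_cons cats1.
by rewrite eqxx IHs !rev_cons -!cats1 -!catA.
Qed.

(** The memory [m] followed by infinitely many zeros is the pointer tape; the pointer is at [p]. *)
Definition represents (m : seq bool) (pr : seq instr) (p : nat) (xs' : seq bool) (fl : bool) (a : ast) :=
  [/\ ys a = double (enc_prog pr) ++ false :: mkseq (nth false m) p, cur a = nth false m p,
      forall i, nth false (zs a) i = nth false m (p + i.+1), xs a = xs' & flg a = fl].

(** The gap and the length of [zs] are left open, so that the rules below compose backwards, like
    weakest preconditions. *)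
Definition outcome m pr p xs fl (r : bool) := forall a, represents m pr p xs fl a -> accepts a = r.

Section Outcome.
Variable m : seq bool.
Implicit Types (pr : seq instr) (xs : seq bool).

Lemma outcome_step i pr p xs fl r :
  (forall a, represents m pr p xs fl a ->
     match exec_op i a with inl a' => accepts a' = r | inr b => b = r end) ->
  outcome m (i :: pr) p xs fl r.
Proof.
move=> H [xs1 g ys1 c1 zs1 fl1] [/= -> -> hz -> ->]; rewrite accepts_eq.
set b := Ast xs (g + 6) (double (enc_prog pr) ++ false :: mkseq (nth false m) p) (nth false m p) zs1 fl.
have -> : exec1 (Ast xs g (double (enc_prog (i :: pr)) ++ false :: mkseq (nth false m) p)
    (nth false m p) zs1 fl) = exec_op i b by case: i {H} => [||[]||||].
by have := H b; case: (exec_op i b) => ? h; apply: h.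
Qed.

Lemma outcome_R pr p xs fl r : outcome m pr p.+1 xs fl r -> outcome m (IR :: pr) p xs fl r.
Proof.
move=> H; apply: outcome_step => -[xs1 g ys1 c1 zs1 fl1] [/= -> -> hz -> ->].
apply: H; split=> //=.
- by rewrite rcons_cat /= mkseqS.
- by have := hz 0; rewrite addn1 -nth0.
by move=> i; rewrite nth_behead hz addSnnS.
Qed.

Lemma outcome_L pr p xs fl r : outcome m pr p xs fl r -> outcome m (IL :: pr) p.+1 xs fl r.
Proof.
move=> H; apply: outcome_step => -[xs1 g ys1 c1 zs1 fl1] [/= -> -> hz -> ->].
rewrite mkseqS -rcons_cons -rcons_cat; set y := rcons _ _.
suff -> : exec_op IL (Ast xs g y (nth false m p.+1) zs1 fl) =
  inl (Ast xs g (double (enc_prog pr) ++ false :: mkseq (nth false m) p) (nth false m p) (nth false m p.+1 :: zs1) fl).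
  by apply: H; split=> //= -[|i] /=; rewrite ?addn1 // hz addSnnS.
rewrite /y /exec_op; case: (double _ ++ _) => [|z s] //=.
by rewrite belast_rcons last_rcons.
Qed.

Lemma outcome_T e pr p xs fl r :
  outcome m pr p xs (fl || (nth false m p == e)) r -> outcome m (IT e :: pr) p xs fl r.
Proof.
move=> H; apply: outcome_step => -[xs1 g ys1 c1 zs1 fl1] [/= -> -> hz -> ->].
by apply: H; split.
Qed.

Lemma outcome_I b c pr p xs fl r :
  outcome m pr p xs (fl || (nth false m p == b)) r -> outcome m (II :: pr) p [:: c, b & xs] fl r.
Proof.
move=> H; apply: outcome_step => -[xs1 g ys1 c1 zs1 fl1] [/= -> -> hz -> ->].
rewrite /exec_op; set y := _ ++ _; case e: y => [|h s].
  by move: e; rewrite /y; case: (double _).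
by rewrite -e; apply: H; split.
Qed.

Lemma outcome_E pr p xs fl r : outcome m pr p xs false r -> outcome m (IE :: pr) p xs fl (fl && r).
Proof.
move=> H; apply: outcome_step => -[xs1 g ys1 c1 zs1 fl1] [/= -> -> hz -> ->].
by rewrite /exec_op; case: fl => //; apply: H; split.
Qed.

Lemma outcome_A pr p xs fl : outcome m (IA :: pr) p xs fl true.
Proof. by apply: outcome_step => -[xs1 g ys1 c1 zs1 fl1]. Qed.

Lemma outcome_Rs k pr p xs fl r :
  outcome m pr (p + k) xs fl r -> outcome m (nseq k IR ++ pr) p xs fl r.
Proof.
elim: k p => [|k IHk] p; first by rewrite addn0.
by rewrite -addSnnS => /IHk h; apply: outcome_R.
Qed.

Lemma outcome_Ls k pr p xs fl r :
  outcome m pr p xs fl r -> outcome m (nseq k IL ++ pr) (p + k) xs fl r.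
Proof.
elim: k p => [|k IHk] p; first by rewrite addn0.
by move=> h; rewrite addnS; apply: outcome_L; apply: IHk.
Qed.

End Outcome.

(** Variable [v] lives in cell [v.+1], because cell 0 comes from the separator. Every visit starts
    and ends at cell 0. *)
Definition visit (v : nat) (i : seq instr) : seq instr := nseq v.+1 IR ++ i ++ nseq v.+1 IL.
Definition lit_prog (l : literal) : seq instr := visit l.1 [:: IT l.2].
Definition clause_prog (C : clause) : seq instr := flatten (map lit_prog C) ++ [:: IE].
Definition cnf_prog (F : cnf) : seq instr := flatten (map clause_prog F).
Definition input_prog (vx : seq nat) : seq instr :=
  flatten [seq visit v [:: II; II] ++ [:: IE] | v <- vx].

(** [II; IT true; IE] discards the two cells left over from the separator: cell 0 of the pointer tape holds [true]. *)
Definition eval_prog (vx : seq nat) (F : cnf) : seq instr :=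
  [:: II; IT true; IE] ++ input_prog (rev vx) ++ cnf_prog F ++ [:: IA].

Definition csat (V : Type) (sigma : V -> bool) (F : seq (seq (V * bool))) : bool :=
  all (fun C => has (fun l => sigma l.1 == l.2) C) F.

Lemma outcome_clause w C pr xs fl r :
  outcome (true :: w) pr 0 xs false r ->
  outcome (true :: w) (clause_prog C ++ pr) 0 xs fl
    ((fl || has (fun l => nth false w l.1 == l.2) C) && r).
Proof.
move=> H; elim: C fl => [|[v b] C IHC] fl; first by rewrite orbF; apply: outcome_E.
rewrite [clause_prog _]/= /clause_prog /= /lit_prog /visit -!catA.
rewrite -[_ :: (nseq _ _ ++ _)]/(nseq v.+1 IR ++ _).
apply: outcome_Rs; apply: outcome_T; apply: (@outcome_Ls _ v.+1 _ 0).
by have := IHC (fl || (nth false w v == b)); rewrite orbA catA.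
Qed.

Lemma outcome_cnf w F pr xs r :
  outcome (true :: w) pr 0 xs false r ->
  outcome (true :: w) (cnf_prog F ++ pr) 0 xs false (csat (nth false w) F && r).
Proof.
move=> H; elim: F => [|C F IHF] //=.
by rewrite /cnf_prog /= -catA -andbA; apply: outcome_clause.
Qed.

(** Each [II] consumes two cells and each input bit fills four, so two of them at the same variable
    test one bit twice; the flag is the same as after one test. *)
Lemma outcome_input w vx x pr xs r : size vx = size x ->
  outcome (true :: w) pr 0 xs false r ->
  outcome (true :: w) (input_prog vx ++ pr) 0 (quad x ++ xs) false
    ((map (nth false w) vx == x) && r).
Proof.
move=> + H; elim: vx x => [|v vx IHv] [|b x] //= [/IHv{}IHv].
rewrite /input_prog /= /visit -!catA -[_ :: (nseq _ _ ++ _)]/(nseq v.+1 IR ++ _).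
apply: outcome_Rs; apply: outcome_I; apply: outcome_I; apply: (@outcome_Ls _ v.+1 _ 0).
rewrite orbb eqseq_cons -andbA.
exact: outcome_E.
Qed.

Lemma run_eval_prog vx F x w : size vx = size x ->
  run_spec (pairS (pairS x (enc_prog (eval_prog vx F))) w) =
  (map (nth false w) vx == x) && csat (nth false w) F.
Proof.
move=> sv; rewrite /run_spec /pairS parse_x_pair parse_a_double /=.
have H : outcome (true :: w) (eval_prog vx F) 0 [:: false, false & quad (rev x) ++ [:: true]] false
  ((map (nth false w) vx == x) && csat (nth false w) F).
  apply: outcome_I; apply: outcome_T; rewrite -[X in outcome _ _ _ _ _ X]andTb.
  (* The input is consumed from its right end, hence the reversal of both sides. *)
  apply: outcome_E; rewrite -(can_eq revK) -map_rev; apply: outcome_input; first by rewrite !size_rev.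
  by rewrite -[X in outcome _ _ _ _ _ X]andbT; apply: outcome_cnf; apply: outcome_A.
by apply: H; split.
Qed.

(** * CNF formulas over structured variables *)

Definition gcnf (V : Type) := seq (seq (V * bool)).

Definition bigcat (I V : Type) (s : seq I) (f : I -> gcnf V) : gcnf V := flatten (map f s).

Definition weight (B : Type) (F : seq (seq B)) : nat := sumn (map (fun C => (size C).+1) F).

Section Gcnf.
Variables (V : Type).
Implicit Types (F G : gcnf V) (sigma : V -> bool).

Lemma csat_cons sigma C F : csat sigma (C :: F) = has (fun l => sigma l.1 == l.2) C && csat sigma F.
Proof. by []. Qed.

Lemma csat_cat sigma F G : csat sigma (F ++ G) = csat sigma F && csat sigma G.
Proof. exact: all_cat. Qed.

Lemma csat_bigcat sigma (I : Type) (s : seq I) (f : I -> gcnf V) :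
  csat sigma (bigcat s f) = all (fun i => csat sigma (f i)) s.
Proof. by elim: s => //= i s IHs; rewrite /bigcat /= csat_cat -IHs. Qed.

End Gcnf.


Section Weight.
Variable B : Type.
Implicit Types F G : seq (seq B).

Lemma weight_cat F G : weight (F ++ G) = weight F + weight G.
Proof. by rewrite /weight map_cat sumn_cat. Qed.

Lemma weight_flatten (I : eqType) (s : seq I) (f : I -> seq (seq B)) b :
  (forall i, i \in s -> weight (f i) <= b) -> weight (flatten (map f s)) <= size s * b.
Proof.
elim: s => //= i s IHs fb; rewrite weight_cat mulSn leq_add ?fb ?mem_head //.
by apply: IHs => j js; apply: fb; rewrite inE js orbT.
Qed.

Lemma weight_map (I : Type) (s : seq I) (f : I -> seq B) b :
  (forall i, size (f i) = b) -> weight (map f s) = size s * b.+1.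
Proof. by move=> fb; elim: s => //= i s IHs; rewrite /weight /= fb mulSn -IHs. Qed.

Lemma size_flatten_weight F : size (flatten F) <= weight F.
Proof. by elim: F => //= C F IHF; rewrite size_cat /weight /=; move: IHF; rewrite /weight; lia. Qed.

End Weight.

(** * Tableaux of Turing machine computations *)

(** The first component distinguishes the kinds of variables. *)
Definition var := (nat * nat * nat * seq bool)%type.

Definition sym_code (a : option bool) : seq bool := if a is Some b then [:: b] else [::].
Lemma sym_code_inj : injective sym_code.
Proof. by case=> [a|] [b|] // [->]. Qed.

Definition St (t q : nat) : var := (0, t, q, [::]).
Definition Cl (t p : nat) (a : option bool) : var := (1, t, p, sym_code a).

Definition syms : seq (option bool) := [:: None; Some false; Some true].

Lemma mem_syms a : a \in syms. Proof. by case: a => [[]|]. Qed.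

(** Tape cells are numbered relative to the head, which always sits at [H]. *)
Definition view (H : nat) (t : tape) (p : nat) : option bool :=
  let: (l, h, r) := t in if p < H then nth None l (H - p.+1) else nth None (h :: r) (p - H).

(** As the head stays at [H], a move shifts the tape instead: cell [p] afterwards is cell [src m p]
    before. *)
Definition src (m : move) (p : nat) : nat :=
  match m with MoveL => p.-1 | MoveR => p.+1 | Stay => p end.

Lemma view_move H m l s r p : 0 < H -> 0 < p ->
  view H (move_tape m (l, s, r)) p = view H (l, s, r) (src m p).
Proof.
move=> H0 p0; case: m => //=.
- case: ltngtP => pH.
  + by rewrite nth_behead; case: ltnP => ?; [congr (nth _ _ _); lia | lia].
  + case: ltnP => ?; first by lia.
    by have -> : p - H = (p.-1 - H).+1 by lia.
  + by rewrite pH subnn /= ltn_predL H0 prednK // subnn nth0.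
- case: (ltnP p H) => pH; case: (ltnP p.+1 H) => pH'; try lia.
  + by have -> : H - p.+1 = (H - p.+2).+1 by lia.
  + have -> : H - p.+1 = 0 by lia.
    by have -> : p.+1 - H = 0 by lia.
  + have -> : p.+1 - H = (p - H).+1 by lia.
    by case: (p - H) => [|k] /=; rewrite ?nth_behead ?nth0.
Qed.

Lemma view_write H l h s r p :
  view H (l, s, r) p = if p == H then s else view H (l, h, r) p.
Proof.
rewrite /=; case: ltngtP => pH //; last by rewrite pH subnn.
by have -> : p - H = (p - H).-1.+1 by lia.
Qed.

Lemma view_head H l h r : view H (l, h, r) H = h.
Proof. by rewrite /= ltnn subnn. Qed.

Arguments view : simpl never.
Arguments step : simpl never.

Section Tableau.
Variable M : TM.

(** Halting configurations repeat themselves, so the result of a shorter run can be read off at the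
    fixed time [T]. *)
Definition full_delta (q : 'I_(tm_n M).+1) (a : option bool) :=
  if tm_halt q then (q, a, Stay) else tm_delta q a.

Lemma step_full q l h r :
  @step M (q, (l, h, r)) =
  let: (q', s, m) := full_delta q h in (q', move_tape m (l, s, r)).
Proof. by rewrite /step /full_delta; case: ifP. Qed.

(** All clauses are implications with one positive conclusion. A model makes at least the variables
    of the true run true, and possibly more; this is enough because the output clauses forbid the
    wrong symbols. *)
Definition step_clauses (H U t : nat) (q : 'I_(tm_n M).+1) (a : option bool) : gcnf var :=
  let: (q', s, m) := full_delta q a in
  [:: (St t q, false); (Cl t H a, false); (St t.+1 q', true)] ::
  bigcat (iota 1 U) (fun p =>
    [seq [:: (St t q, false); (Cl t H a, false); (Cl t (src m p) c, false);
             (Cl t.+1 p (if src m p == H then s else c), true)] | c <- syms]).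

Definition tableau (T H U : nat) : gcnf var :=
  bigcat (iota 0 T) (fun t => bigcat (enum 'I_(tm_n M).+1) (fun q =>
    bigcat syms (step_clauses H U t q))).

Lemma tableau_stepP sigma T H U t q a : csat sigma (tableau T H U) -> t < T ->
  csat sigma (step_clauses H U t q a).
Proof.
rewrite csat_bigcat => /allP/(_ t) + tT; rewrite mem_iota add0n tT => /(_ isT).
rewrite csat_bigcat => /allP/(_ q); rewrite mem_enum => /(_ isT).
by rewrite csat_bigcat => /allP/(_ a); rewrite mem_syms => /(_ isT).
Qed.

(** Information travels one cell per step, so row [t] is determined on the cells from [t] to [U - t] only. *)
Lemma tableau_sound sigma T H U c0 : csat sigma (tableau T H U) -> T < H -> H + T <= U ->
  sigma (St 0 (nat_of_ord c0.1)) -> (forall p, p <= U -> sigma (Cl 0 p (view H c0.2 p))) ->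
  forall t, t <= T -> sigma (St t (nat_of_ord (iter t (@step M) c0).1)) /\
    (forall p, t <= p -> p + t <= U -> sigma (Cl t p (view H (iter t (@step M) c0).2 p))).
Proof.
move=> sF TH HU s0 v0; elim=> [|t IHt] tT.
  by split=> // p _ pU; apply: v0; lia.
have [] := IHt (ltnW tT); rewrite iterS; case: (iter t _ c0) => q [[l h] r] /= sq sv.
have := tableau_stepP q h sF tT; rewrite step_full /step_clauses.
case: (full_delta q h) => [[q' s] m] /= /andP[].
have sH : sigma (Cl t H h) by have := sv H; rewrite view_head; apply; lia.
rewrite sq sH /= orbF => /eqP sq' cells; split; first by rewrite sq'.
move=> p tp pU; have p1 : p \in iota 1 U by rewrite mem_iota; lia.
move: cells; rewrite csat_bigcat => /allP/(_ p p1) /=.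
set p' := src m p; have sp' : sigma (Cl t p' (view H (l, h, r) p')).
  by apply: sv; rewrite /p'; case: (m) => /=; lia.
rewrite view_move; try lia.
rewrite (view_write H l h) -/p' sq sH /= !andbT !orbF.
move: sp'; case: (view H (l, h, r) p') => [[]|] -> /=.
all: by case/and3P=> /eqP c1 /eqP c2 /eqP c3; case: (p' == H) c1 c2 c3.
Qed.

Lemma tableau_complete sigma T H U c0 : 0 < H ->
  (forall t q, sigma (St t q) = (q == (iter t (@step M) c0).1 :> nat)) ->
  (forall t p a, sigma (Cl t p a) = (a == view H (iter t (@step M) c0).2 p)) ->
  csat sigma (tableau T H U).
Proof.
move=> H0 hS hC; rewrite csat_bigcat; apply/allP => t _.
rewrite csat_bigcat; apply/allP => q _; rewrite csat_bigcat; apply/allP => a _.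
have := hS t.+1; have := hC t.+1; have := hS t; have := hC t; rewrite iterS.
case: (iter t _ c0) => q0 [[l h] r] /= Ct St' Ct1 St1.
rewrite /step_clauses; case e : (full_delta q a) => [[q' s] m].
(* For any pair other than the actual state and scanned symbol, a premise of each clause fails. *)
have [[eq ea]|ne] : (q = q0 /\ a = h) \/ ~~ (sigma (St t q) && sigma (Cl t H a)).
  rewrite St' Ct view_head /=; case: (eqVneq (q : nat) q0) => [/val_inj|] /=; last by right.
  by case: (eqVneq a h); [left | right].
- subst; move: Ct1 St1; rewrite step_full e => Ct1 St1.
  rewrite csat_cons [has _ _]/= St1 eqxx !orbT csat_bigcat; apply/allP => p; rewrite mem_iota => /andP[p0 _].
  rewrite /csat all_map; apply/allP => b _ /=.
  rewrite Ct1 view_move // (view_write H l h) (Ct (src m p) b).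
  have [-> |ne] := eqVneq b (view H (l, h, r) (src m p)); last by rewrite !orbT.
  by case: ifP => _; rewrite eqxx !orbT.
- have ne' : (sigma (St t q) == false) || (sigma (Cl t H a) == false) by rewrite !eqbF_neg -negb_and.
  rewrite csat_cons [has _ _]/= orbA ne' csat_bigcat; apply/allP => p _.
  by rewrite /csat all_map; apply/allP => b _ /=; rewrite orbA ne'.
Qed.

End Tableau.

(** * Runs on strings whose bits are constants or literals *)

Definition sbit := (bool + var * bool)%type.

Definition beval (sigma : var -> bool) (e : sbit) : bool :=
  match e with inl b => b | inr l => sigma l.1 == l.2 end.

Definition cell_is (p : nat) (e : sbit) : gcnf var :=
  match e with
  | inl b => [:: [:: (Cl 0 p (Some b), true)]]
  | inr (v, s) => [:: [:: (v, ~~ s); (Cl 0 p (Some true), true)];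
                      [:: (v, s); (Cl 0 p (Some false), true)]]
  end.

(** A blank forces the next cell to be blank, so the free cells hold a string of length at most
    their number, padded with blanks. *)
Definition cell_free (p : nat) : gcnf var :=
  [:: [:: (Cl 0 p None, true); (Cl 0 p (Some false), true); (Cl 0 p (Some true), true)];
      [:: (Cl 0 p None, false); (Cl 0 p.+1 None, true)]].

Definition cell_blank (p : nat) : gcnf var := [:: [:: (Cl 0 p None, true)]].

Lemma view_init (M : TM) H x p :
  view H (@init M x).2 p = if p < H then None else nth None (map Some x) (p - H).
Proof.
rewrite /view /=; case: ifP => _; first exact: nth_nil.
by case: x => [|a x] //=; case: (p - H) => [|[|k]].
Qed.

Lemma mem_iota0 n i : (i \in iota 0 n) = (i < n).
Proof. by rewrite mem_iota add0n. Qed.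

Section Run.
Variables (M : TM) (pre : seq sbit) (P : nat).

Definition input_clauses (H U : nat) : gcnf var :=
  [:: (St 0 0, true)] ::
  bigcat (iota 0 H) cell_blank
  ++ bigcat (iota 0 (size pre)) (fun i => cell_is (H + i) (nth (inl false) pre i))
  ++ bigcat (iota 0 P) (fun i => cell_free (H + size pre + i))
  ++ bigcat (iota (H + size pre + P) (U + 1)) cell_blank.

Lemma input_sound sigma H U : csat sigma (input_clauses H U) ->
  exists w, [/\ size w <= P, sigma (St 0 0) &
    forall p, p <= U -> sigma (Cl 0 p (view H (@init M (map (beval sigma) pre ++ w)).2 p))].
Proof.
rewrite /input_clauses csat_cons !csat_cat !csat_bigcat.
case/andP=> s0 /and4P[/allP blankL /allP fixed /allP free /allP blankR].
move: s0; rewrite /= orbF => /eqP s0.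
pose blank i := sigma (Cl 0 (H + size pre + i) None).
(* The guessed string ends at the first free cell marked blank. *)
pose k := find blank (iota 0 P).
have kP : k <= P by rewrite -(size_iota 0 P) find_size.
have blank_mono i j : i <= j -> j <= P -> 0 < P -> blank i -> blank j.
  move=> ij jP P0 bi; elim: j ij jP => [|j IHj]; first by case: i bi.
  rewrite leq_eqVlt => /orP[/eqP <- //|] ij jP.
  have /= := free j; rewrite mem_iota0 jP => /(_ isT).
  have := IHj ij (ltnW jP); rewrite /blank => -> /=.
  by rewrite addnS orbF andbT => /eqP.
(* A model may mark both bits in one cell; then [true] is taken. *)
pose w := mkseq (fun i => sigma (Cl 0 (H + size pre + i) (Some true))) k.
exists w; split=> //; first by rewrite size_mkseq.
move=> p pU; rewrite (view_init M); case: (ltnP p H) => pH.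
  have := blankL p; rewrite mem_iota0 pH /= orbF andbT => /(_ isT). by move=> /eqP.
rewrite map_cat nth_cat !size_map; case: (ltnP (p - H) (size pre)) => ps.
  have := fixed (p - H); rewrite mem_iota0 ps => /(_ isT).
  rewrite (nth_map false) ?size_map // (nth_map (inl false)) // subnKC //.
  case: (nth _ _ _) => [b|[v s]] /=; first by rewrite orbF andbT => /eqP.
  by case: (sigma v) s => [] [] /=; rewrite ?andbT ?orbF /= => /eqP.
set i := p - H - size pre; have ip : p = H + size pre + i by rewrite /i; lia.
case: (ltnP i k) => ik.
  rewrite (nth_map false) ?size_mkseq // nth_mkseq // ip.
  have iP : i \in iota 0 P by rewrite mem_iota0 (leq_trans ik).
  have := free i iP; have := before_find 0 ik; rewrite nth_iota ?add0n; last exact: leq_trans ik kP.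
  rewrite /blank /cell_free /= => -> /= /andP[+ _].
  by case e : (sigma (Cl 0 (H + size pre + i) (Some true))) => //=; rewrite orbF => /eqP.
rewrite nth_default ?size_map ?size_iota //.
case: (ltnP i P) => iP.
  have hk : has blank (iota 0 P) by rewrite has_find size_iota; apply: leq_ltn_trans iP.
  have := nth_find 0 hk; rewrite -/k nth_iota ?add0n; last exact: leq_ltn_trans iP.
  by rewrite ip; apply: blank_mono; lia.
have := blankR p; rewrite mem_iota /= orbF andbT => h; apply/eqP; apply: h.
clearbody i; lia.
Qed.

Lemma input_complete (sigma : var -> bool) H U w : size w <= P ->
  sigma (St 0 0) ->
  (forall p a, sigma (Cl 0 p a) = (a == view H (@init M (map (beval sigma) pre ++ w)).2 p)) ->
  csat sigma (input_clauses H U).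
Proof.
move=> wP s0 hC; have {}hC p a : sigma (Cl 0 p a) =
  (a == if p < H then None else nth None (map Some (map (beval sigma) pre ++ w)) (p - H)).
  by rewrite hC (view_init M).
have blank p : (p < H) || (H + size pre + size w <= p) -> sigma (Cl 0 p None).
  rewrite hC; case: ltnP => //= pH h; rewrite nth_default // size_map size_cat size_map; lia.
rewrite /input_clauses csat_cons !csat_cat !csat_bigcat.
apply/andP; split; first by rewrite /= s0.
apply/and4P; split; apply/allP => i; rewrite ?mem_iota0 ?mem_iota.
- by move=> iH; rewrite /= blank ?iH.
- move=> ip; have hc b : sigma (Cl 0 (H + i) (Some b)) = (b == beval sigma (nth (inl false) pre i)).
    rewrite hC ltnNge leq_addr /= addKn (nth_map false) ?size_cat ?size_map; last by lia.
    by rewrite nth_cat size_map ip (nth_map (inl false)).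
  case e : (nth _ _ _) => [b|[v s]]; rewrite /= !hc e /=; first by rewrite eqxx.
  by case: (sigma v) s {e} => [] [].
- move=> iP; rewrite /cell_free /=.
  have [wi|wi] := leqP (size w) i.
    rewrite !blank //; apply/orP; right; lia.
  rewrite !hC ltnNge -addnA leq_addr /= addKn.
  rewrite (nth_map false) ?size_cat ?size_map; last by lia.
  by rewrite (inj_eq Some_inj); case: (nth _ _ _).
- by move=> ip; rewrite /= blank //; apply/orP; right; lia.
Qed.

End Run.

Definition out_cell (t : tape) (p : nat) : option bool := let: (_, h, r) := t in nth None (h :: r) p.

Lemma view_out H t p : view H t (H + p) = out_cell t p.
Proof. by case: t => [[l h] r]; rewrite /view ltnNge leq_addr addKn. Qed.

Lemma tape_outP t z :
  tape_out t = z <-> (forall p, p <= size z -> out_cell t p = nth None (map Some z) p).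
Proof.
case: t => [[l h] r]; rewrite /tape_out /out_cell.
elim: z (h :: r) => [|b z IHz] s; split.
- by case: s => [|[b|] s] h0 [|p].
- by move=> /(_ 0 isT); case: s => [|[]].
- case: s => [|[c|] s] //= [-> /IHz h'] [|p] //= pz; exact: h'.
- move=> h'; have := h' 0 isT; case: s h' => [|[c|] s] //= h' [->]; congr (_ :: _).
  by apply/IHz => p pz; apply: (h' p.+1).
Qed.

(** With the head at [T.+1], a window of this size still determines output cells 0 to [m] in row
    [T], where [T] cells are lost on either side. *)
Definition run_window (T N m : nat) : nat := T.+1 + T + N + m.

Definition run_clauses (M : TM) (T : nat) (pre : seq sbit) (P m : nat) : gcnf var :=
  input_clauses pre P T.+1 (run_window T (size pre + P) m) ++
  tableau M T T.+1 (run_window T (size pre + P) m).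

Definition run_assign (M : TM) (T : nat) (x : seq bool) (tau : var -> bool) (v : var) : bool :=
  let: (k, t, p, s) := v in
  match k with
  | 0 => p == (iter t (@step M) (@init M x)).1
  | 1 => s == sym_code (view T.+1 (iter t (@step M) (@init M x)).2 p)
  | _ => tau v
  end.

(** Position [size z] is included: there [nth] defaults to a blank, which fixes the end of the
    output. A true guard literal switches the clauses off. *)
Definition output_clauses (T : nat) (guard : seq (var * bool)) (z : seq bool) : gcnf var :=
  bigcat (iota 0 (size z).+1) (fun p =>
    [seq rcons guard (Cl T (T.+1 + p) a, false) | a <- syms & a != nth None (map Some z) p]).

Definition final_tape (M : TM) (T : nat) (x : seq bool) : tape := (iter T (@step M) (@init M x)).2.

Lemma run_sound sigma M T pre P m : csat sigma (run_clauses M T pre P m) ->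
  exists2 w, size w <= P & forall p, p <= m ->
    sigma (Cl T (T.+1 + p) (out_cell (final_tape M T (map (beval sigma) pre ++ w)) p)).
Proof.
rewrite csat_cat => /andP[/(input_sound M) [w [wP s0 v0]] tabl]; exists w => // p pm.
have TU : T.+1 + T <= run_window T (size pre + P) m by rewrite /run_window; lia.
have [_ cells] := @tableau_sound M sigma _ _ _ (init M _) tabl (ltnSn T) TU s0 v0 T (leqnn T).
rewrite -(view_out T.+1); apply: cells; rewrite /run_window; lia.
Qed.

(** Symbolic bits keep to kinds 2 to 4: kinds 0 and 1 are overwritten by the tableau, kinds 5 to 7
    when a model of the non-membership formula is built. *)
Definition outer_bit (e : sbit) : bool := if e is inr l then 1 < l.1.1.1.1 < 5 else true.

Lemma beval_assign M T x tau e : outer_bit e -> beval (run_assign M T x tau) e = beval tau e.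
Proof. by case: e => [//|[[[[[|[|k]] t] p] s] b]]. Qed.

Lemma run_complete tau M T pre P m w x : size w <= P -> all outer_bit pre ->
  x = map (beval tau) pre ++ w -> csat (run_assign M T x tau) (run_clauses M T pre P m).
Proof.
move=> wP opre xE.
have ex : map (beval (run_assign M T x tau)) pre ++ w = x.
  rewrite xE; congr (_ ++ _); apply/eq_in_map => e /(allP opre); exact: beval_assign.
have hC t p a : run_assign M T x tau (Cl t p a) = (a == view T.+1 (iter t (@step M) (@init M x)).2 p).
  by rewrite /= (inj_eq sym_code_inj).
rewrite /run_clauses csat_cat; apply/andP; split; last exact: (@tableau_complete _ _ _ _ _ (init M x)).
by apply: (@input_complete M pre P _ _ _ w) => // p a; rewrite ex hC.
Qed.

Lemma output_sound sigma T guard z t : csat sigma (output_clauses T guard z) ->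
  ~~ has (fun l => sigma l.1 == l.2) guard ->
  (forall p, p <= size z -> sigma (Cl T (T.+1 + p) (out_cell t p))) -> tape_out t = z.
Proof.
rewrite csat_bigcat => /allP out ng cells; apply/tape_outP => p pz.
have := out p; rewrite mem_iota0 ltnS pz => /(_ isT); rewrite /csat all_map all_filter => /allP.
move=> /(_ (out_cell t p) (mem_syms _)) /=; rewrite has_rcons /= (negPf ng) cells //.
by case: eqP.
Qed.

Lemma output_complete sigma M T x guard z :
  (forall t p a, sigma (Cl t p a) = (a == view T.+1 (iter t (@step M) (@init M x)).2 p)) ->
  has (fun l => sigma l.1 == l.2) guard \/ tape_out (final_tape M T x) = z ->
  csat sigma (output_clauses T guard z).
Proof.
move=> hC h; rewrite csat_bigcat; apply/allP => p; rewrite mem_iota0 ltnS => pz.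
rewrite /csat all_map all_filter; apply/allP => a _ /=; apply/implyP => ne; rewrite has_rcons /=.
case: h => [-> | /tape_outP/(_ p pz) e]; first by rewrite orbT.
by rewrite hC view_out e (negPf ne).
Qed.

(** * Prefix codes *)

Definition prefix_code (X : Type) (enc : X -> seq bool) :=
  forall a b s t, enc a ++ s = enc b ++ t -> a = b /\ s = t.

Lemma prefix_code_seq (X : Type) (enc : X -> seq bool) (e : seq bool) :
  prefix_code enc -> (forall a s t, enc a ++ s <> e ++ t) ->
  prefix_code (fun l => flatten (map enc l) ++ e).
Proof.
move=> penc ne; elim=> [|a l IHl] [|b l'] s t /=; rewrite -?catA.
- by move/eqP; rewrite eqseq_cat // => /andP[_ /eqP].
- by move=> h; case: (ne b (flatten (map enc l') ++ e ++ t) s).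
- by move=> h; case: (ne a (flatten (map enc l) ++ e ++ s) t).
- by move=> /penc[-> h]; have [] := IHl l' s t; rewrite -?catA // => -> ->.
Qed.

Lemma bits_auxK fuel n : n <= fuel -> foldr (fun (b : bool) m => b + m.*2) 0 (bits_aux fuel n) = n.
Proof.
elim: fuel n => [|f IHf] n /=; first by rewrite leqn0 => /eqP.
by case: eqP => [-> //|n0] nf /=; rewrite IHf ?odd_double_half //; lia.
Qed.

Lemma nat_bits_inj : injective nat_bits.
Proof. by move=> m n h; rewrite -(bits_auxK (leqnn m)) -/(nat_bits m) h bits_auxK. Qed.

Lemma enc_nat_prefix : prefix_code enc_nat.
Proof.
move=> m n s t h.
have [||/nat_bits_inj -> ->] // := @prefix_code_seq _ (fun b : bool => if b then tok1 else tok0) tokSep _ _ _ _ _ _ h.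
  by move=> [] [] s' t' // [].
by move=> [] s' t'.
Qed.

Lemma enc_lit_prefix : prefix_code enc_lit.
Proof.
move=> [v b] [v' b'] s t; rewrite /enc_lit /=.
by case: b b' => [] [] //= [] /enc_nat_prefix[-> ->].
Qed.

Lemma enc_clause_prefix : prefix_code enc_clause.
Proof. by apply: prefix_code_seq enc_lit_prefix _ => -[v []]. Qed.

Lemma enc_cnf_prefix : prefix_code enc_cnf.
Proof. by apply: prefix_code_seq enc_clause_prefix _ => -[|[v []] C]. Qed.

Lemma enc_pk_inj x k x' k' : enc_pk x k = enc_pk x' k' -> x = x' /\ k = k'.
Proof.
have p : prefix_code (fun x => double x ++ [:: false; true]).
  by apply: prefix_code_seq => [[] [] s t // []|[]].
rewrite /enc_pk !catA => /p[-> h]; split=> //.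
by rewrite -(size_nseq k true) h size_nseq.
Qed.

(** * The set of all variables is a backdoor *)

Definition scoped (V : eqType) (B : seq V) (F : gcnf V) : bool := all (all (fun l => l.1 \in B)) F.

Lemma scoped_backdoor A F B : is_subsolver A -> scoped B F -> backdoor A F B.
Proof.
move=> [_ [_ [_ [A0 [A1 _]]]]] /allP sFB tau tB.
case e : (restrict F tau) => [|C G] //; rewrite -e; apply: A1; first by rewrite e.
apply/allP => D /mapP[C']; rewrite mem_filter => /andP[/hasPn nt C'F] ->.
rewrite -size_eq0 size_filter -leqn0 leqNgt -has_count -all_predC; apply/allP => l lC /=.
have := nt l lC; have := tB l.1; rewrite (allP (sFB _ C'F)) // /lit_true /lit_false.
by case: (tau l.1) => // -[]; case: (l.2).
Qed.

Lemma SAT_backdoorP A F B : is_subsolver A -> uniq B -> scoped B F ->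
  SAT_backdoor A (enc_instance F B) (size B) <-> satisfiable F.
Proof.
move=> sA uB sF; split=> [[F' [B' [+ [_ [_ [_]]]]]]|satF].
  (* [SAT_backdoor] quantifies over decodings of the string; the prefix property identifies [F']
     with [F]. *)
  by move=> /enc_cnf_prefix[-> _].
by exists F, B; do ![split=> //]; apply: scoped_backdoor.
Qed.

(** * The covering argument of Fortnow and Santhanam *)

Section Cover.
Variables (U I W : finType) (h : {ffun I -> U} -> W).
Hypotheses (I0 : 0 < #|I|) (WI : #|W| <= 2 ^ #|I|).
Implicit Types (A : {set U}) (z : W).

Definition reached A z : {set U} :=
  [set x in A | [exists X : {ffun I -> U}, [&& X \in ffun_on (mem A), h X == z & [exists i, X i == x]]]].

(** Families over [A] with value [z] have all members in [reached A z], so [#|A| ^ #|I|] is at most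
    the sum of the [#|reached A z| ^ #|I|]. If every reached set had less than half of [A], then
    [2 ^ #|I|] times this sum would be at most [#|W| * #|A|.-1 ^ #|I|], which is too small as
    [#|W| <= 2 ^ #|I|]. *)
Lemma halving A : A != set0 -> exists z, #|A| <= 2 * #|reached A z|.
Proof.
move=> A0; apply/existsP; apply: contraT; rewrite negb_exists => /forallP small.
have cA : 0 < #|A| by rewrite card_gt0.
have sub z : #|[set X : {ffun I -> U} | (X \in ffun_on (mem A)) && (h X == z)]| <= #|reached A z| ^ #|I|.
  rewrite -(card_ffun_on I (mem (reached A z))); apply: subset_leq_card; apply/subsetP => X.
  rewrite inE => /andP[XA hX]; apply/ffun_onP => i; rewrite inE (ffun_onP XA) /=.
  by apply/existsP; exists X; rewrite XA hX; apply/existsP; exists i.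
have part : #|A| ^ #|I| <= \sum_(z : W) #|reached A z| ^ #|I|.
  rewrite -(card_ffun_on I (mem A)) -sum1_card (partition_big h predT) //=.
  apply: leq_sum => z _; apply: leq_trans (sub z); rewrite sum1_card.
  by apply: subset_leq_card; apply/subsetP => X; rewrite !inE.
suff : 2 ^ #|I| * #|A| ^ #|I| <= 2 ^ #|I| * #|A|.-1 ^ #|I|.
  by rewrite leq_pmul2l ?expn_gt0 // leq_exp2r // leqNgt ltn_predL cA.
apply: leq_trans (leq_mul (leqnn _) part) _.
rewrite big_distrr /=; apply: (@leq_trans (\sum_(z : W) #|A|.-1 ^ #|I|)).
  apply: leq_sum => z _; rewrite -expnMn leq_exp2r //.
  by have := small z; rewrite -ltnNge; lia.
by rewrite sum_nat_const leq_mul.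
Qed.

(** By [halving], removing a suitable reached set leaves at most half of [A], so [n] rounds exhaust
    it. Families over the remainder are families over [A], so the values found later remain
    realized. *)
Lemma value_cover n A : #|A| < 2 ^ n -> exists Z : seq W,
  [/\ size Z <= n,
      forall x, x \in A -> exists2 X : {ffun I -> U}, h X \in Z & exists i, X i = x
    & forall z, z \in Z -> exists2 X : {ffun I -> U}, h X = z & forall i, X i \in A].
Proof.
elim: n A => [|n IHn] A cA.
  exists [::]; split=> // x; have -> : A = set0 by apply/eqP; rewrite -cards_eq0; lia.
  by rewrite inE.
have [->|A0] := eqVneq A set0; first by exists [::]; split=> // x; rewrite inE.
have [z hz] := halving A0; set S := reached A z in hz.
have SA : S \subset A by apply/subsetP => x; rewrite inE => /andP[].
have [|Z [sZ covZ realZ]] := IHn (A :\: S).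
  by move: cA; rewrite cardsD (setIidPr SA) expnS; have := subset_leq_card SA; lia.
exists (z :: Z); split=> [//|x xA|z'].
  have [|xS] := boolP (x \in S).
    rewrite inE => /andP[_ /existsP[X /and3P[_ /eqP hX /existsP[i /eqP Xi]]]].
    by exists X; [rewrite hX mem_head | exists i].
  by have [|X hX Xx] := covZ x; [rewrite inE xS | exists X; rewrite // inE hX orbT].
rewrite inE => /orP[/eqP ->|/realZ[X <- XA]]; last first.
  by exists X => // i; have := XA i; rewrite inE => /andP[].
have : S != set0 by rewrite -card_gt0; move: A0; rewrite -card_gt0; lia.
case/set0Pn => x; rewrite inE => /andP[_ /existsP[X /and3P[/ffun_onP XA /eqP hX _]]].
by exists X.
Qed.

End Cover.

Lemma computes_final M f Tm x T : computes_in M f Tm -> Tm (size x) <= T ->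
  tape_out (final_tape M T x) = f x.
Proof.
move=> /(_ x)[t [tT [hlt out]]] TT; rewrite -out /final_tape.
have -> : T = (T - t) + t by lia.
have fixed : step (iter t (@step M) (init M x)) = iter t (@step M) (init M x).
  by move: hlt; case: (iter t _ _) => q [[l h] r] /= hlt; rewrite /step hlt.
by rewrite iterD; congr (tape_out _.2); elim: (T - t) => //= k ->.
Qed.

(** [Yv]: the instance, [Sv]: selectors, [Xv i]: the family of instances, [Iv]: the input,
    [Gv i]: the input is the [i]-th member, [Rv z]: the kernel output is [z]. *)
Definition Yv (j : nat) : var := (2, j, 0, [::]).
Definition Sv (b : nat) : var := (3, b, 0, [::]).
Definition Xv (i : seq bool) (j : nat) : var := (4, j, 0, i).
Definition Iv (j : nat) : var := (5, j, 0, [::]).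
Definition Gv (i : seq bool) : var := (6, 0, 0, i).
Definition Rv (z : seq bool) : var := (7, 0, 0, z).

(** * Witness existence as a CNF formula *)

Definition pair_bits (n : nat) : seq sbit :=
  flatten [seq [:: inr (Yv j, true); inr (Yv j, true)] | j <- iota 0 n] ++ [:: inl false; inl true].

Lemma beval_pair_bits sigma n w :
  map (beval sigma) (pair_bits n) ++ w = pairS (mkseq (sigma \o Yv) n) w.
Proof.
rewrite /pair_bits map_cat /= -catA /pairS /mkseq; congr (_ ++ _).
by elim: (iota 0 n) => //= j s ->; rewrite !eqb_id.
Qed.

Lemma size_pair_bits n : size (pair_bits n) = 2 * n + 2.
Proof.
rewrite size_cat; congr (_ + _); rewrite -[in RHS](size_iota 0 n).
by elim: (iota 0 n) => //= j s ->; rewrite mulnS.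
Qed.

Definition Phi (M : TM) (T n P : nat) : gcnf var :=
  run_clauses M T (pair_bits n) P 1 ++ output_clauses T [::] [:: true].

Lemma Phi_sound M T n P sigma : csat sigma (Phi M T n P) ->
  exists2 w, size w <= P & tape_out (final_tape M T (pairS (mkseq (sigma \o Yv) n) w)) = [:: true].
Proof.
rewrite csat_cat => /andP[/run_sound[w wP cells] out]; exists w => //.
by rewrite -beval_pair_bits; apply: output_sound out _ cells.
Qed.

Lemma Phi_complete M T n P tau w x : size w <= P -> x = pairS (mkseq (tau \o Yv) n) w ->
  tape_out (final_tape M T x) = [:: true] -> csat (run_assign M T x tau) (Phi M T n P).
Proof.
move=> wP xE out; rewrite csat_cat; apply/andP; split.
  apply: run_complete wP _ _; last by rewrite beval_pair_bits.
  by rewrite /pair_bits all_cat andbT; elim: (iota 0 n).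
apply: (@output_complete _ M T x); last by right.
by move=> t p a; rewrite /= (inj_eq sym_code_inj).
Qed.

(** * Disjunction of instances *)

Definition indices (l : nat) : seq (seq bool) := map val (enum {: l.-tuple bool}).

Lemma mem_indices l i : (i \in indices l) = (size i == l).
Proof.
apply/mapP/idP => [[t _ ->]|il]; first by rewrite size_tuple.
by exists (Tuple il); rewrite ?mem_enum.
Qed.

Lemma size_indices l : size (indices l) = 2 ^ l.
Proof. by rewrite size_map -cardE card_tuple card_bool. Qed.

(** If the selectors spell [i], then [y] is [X_i]; only the polarities depend on [X]. *)
Definition select_clauses (l n : nat) : seq (seq (var * sbit)) :=
  flatten [seq [seq rcons [seq (Sv b, inl (~~ nth false i b)) | b <- iota 0 l] (Yv j, inr (Xv i j, true))
    | j <- iota 0 n] | i <- indices l].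

Definition lift_cnf (F : gcnf var) : seq (seq (var * sbit)) :=
  [seq [seq (l.1, inl l.2) | l <- C] | C <- F].

Definition or_instance (F : gcnf var) (l n : nat) : seq (seq (var * sbit)) :=
  lift_cnf F ++ select_clauses l n.

Definition inst (tau : var -> bool) (F : seq (seq (var * sbit))) : gcnf var :=
  [seq [seq (l.1, beval tau l.2) | l <- C] | C <- F].

Lemma inst_lift tau F : inst tau (lift_cnf F) = F.
Proof.
rewrite /inst /lift_cnf -map_comp -[RHS]map_id; apply: eq_map => C /=.
by rewrite -map_comp -[RHS]map_id; apply: eq_map => -[].
Qed.

Lemma inst_cat tau F G : inst tau (F ++ G) = inst tau F ++ inst tau G.
Proof. exact: map_cat. Qed.

Lemma csat_selectP tau sigma l n :
  csat sigma (inst tau (select_clauses l n)) <->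
  (forall j, j < n -> sigma (Yv j) = tau (Xv (mkseq (sigma \o Sv) l) j)).
Proof.
have -> : csat sigma (inst tau (select_clauses l n)) =
  all (fun i => all (fun j => has (fun b => sigma (Sv b) == ~~ nth false i b) (iota 0 l) ||
    (sigma (Yv j) == tau (Xv i j))) (iota 0 n)) (indices l).
  rewrite /select_clauses; elim: (indices l) => //= i s IHs.
  rewrite inst_cat csat_cat IHs; congr (_ && _).
  rewrite /csat /inst !all_map; apply: eq_all => j /=.
  by rewrite has_map has_rcons /= has_map orbC eqb_id; congr (_ || _); apply: eq_has.
split=> [/allP h j jn|h].
  have := h (mkseq (sigma \o Sv) l); rewrite mem_indices size_mkseq eqxx => /(_ isT).
  move/allP/(_ j); rewrite mem_iota0 jn => /(_ isT) /orP[/hasP[b]|/eqP //].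
  by rewrite mem_iota0 => bl; rewrite nth_mkseq //=; case: (sigma _).
apply/allP => i; rewrite mem_indices => /eqP il; apply/allP => j; rewrite mem_iota0 => jn.
have [->|ne] := eqVneq i (mkseq (sigma \o Sv) l); first by rewrite h // eqxx orbT.
apply/orP; left; apply: contraT => nh; case/eqP: ne.
apply: (@eq_from_nth _ false); rewrite ?size_mkseq // il => b bl.
have := hasPn nh b; rewrite mem_iota0 bl nth_mkseq // => /(_ isT) /=.
by case: (sigma _); case: (nth _ _ _).
Qed.

Lemma or_instanceP M T n P l tau :
  (exists sigma, csat sigma (inst tau (or_instance (Phi M T n P) l n))) <->
  exists2 i, size i = l & exists2 w, size w <= P &
    tape_out (final_tape M T (pairS (mkseq (fun j => tau (Xv i j)) n) w)) = [:: true].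
Proof.
have mkE (f g : nat -> bool) : (forall j, j < n -> f j = g j) -> mkseq f n = mkseq g n.
  by move=> fg; apply/eq_in_map => j; rewrite mem_iota0; apply: fg.
split=> [[sigma]|[i il [w wP out]]].
  rewrite inst_cat inst_lift csat_cat => /andP[/Phi_sound[w wP out] /csat_selectP h].
  exists (mkseq (sigma \o Sv) l); first by rewrite size_mkseq.
  by exists w => //; rewrite -(mkE _ _ h).
pose tau' (v : var) : bool := let: (k, b, _, _) := v in
  if k == 2 then tau (Xv i b) else nth false i b.
exists (run_assign M T (pairS (mkseq (tau' \o Yv) n) w) tau').
rewrite inst_cat inst_lift csat_cat; apply/andP; split; first exact: Phi_complete wP _ out.
apply/csat_selectP => j jn /=; congr (tau (Xv _ j)).
apply: (@eq_from_nth _ false); rewrite ?size_mkseq // => b bl.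
by rewrite nth_mkseq // -il.
Qed.

(** * Numbering the variables *)

Section Rename.
Variables (V : eqType) (vs : seq V).

Definition rename (B : Type) (F : seq (seq (V * B))) : seq (seq (nat * B)) :=
  [seq [seq (index l.1 vs, l.2) | l <- C] | C <- F].

Lemma csat_rename sigma F : csat sigma (rename F) = csat (fun v => sigma (index v vs)) F.
Proof. by rewrite /csat all_map; apply: eq_all => C /=; rewrite has_map. Qed.

Lemma csat_rename_nth (v0 : V) sigma F : scoped vs F ->
  csat (fun i => sigma (nth v0 vs i)) (rename F) = csat sigma F.
Proof.
move=> /allP sF; rewrite csat_rename; apply: eq_in_all => C /sF/allP sC.
by apply: eq_in_has => l /sC lv; rewrite nth_index.
Qed.

Lemma scoped_rename F : scoped vs F -> scoped (iota 0 (size vs)) (rename F).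
Proof.
move=> /allP sF; rewrite /scoped all_map; apply/allP => C /sF/allP sC /=.
by rewrite all_map; apply/allP => l /sC lv /=; rewrite mem_iota0 index_mem.
Qed.

Lemma satisfiable_rename (v0 : V) F : scoped vs F ->
  satisfiable (rename F) <-> exists sigma, csat sigma F.
Proof.
move=> sF; split=> [[sigma h]|[sigma h]].
  by exists (fun v => sigma (index v vs)); rewrite -csat_rename.
by exists (fun i => sigma (nth v0 vs i)); move: h; rewrite -(csat_rename_nth v0 _ sF).
Qed.

Lemma scopedW (vs' : seq V) F : {subset vs <= vs'} -> scoped vs F -> scoped vs' F.
Proof. by move=> s; apply: sub_all => C; apply: sub_all => l; apply: s. Qed.

End Rename.

Definition vars (V B : Type) (F : seq (seq (V * B))) : seq V := map fst (flatten F).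

Lemma scoped_vars (V : eqType) (F : gcnf V) : scoped (vars F) F.
Proof.
apply/allP => C CF; apply/allP => l lC; apply: map_f; apply/flattenP; exists C => //.
Qed.

(** * Symbolic encoding of instances *)

Definition bneg (e : sbit) : sbit :=
  match e with inl b => inl (~~ b) | inr (v, s) => inr (v, ~~ s) end.

Definition const_bits (s : seq bool) : seq sbit := map inl s.

(** The tokens of positive and negative literals are 101 and 110, so polarity [b] is encoded as 1,
    not [b], [b]. The encoding thus has a fixed shape, and only these bits vary with the family. *)
Definition enc_slit (l : nat * sbit) : seq sbit :=
  [:: inl true; bneg l.2; l.2] ++ const_bits (enc_nat l.1).
Definition enc_sclause (C : seq (nat * sbit)) : seq sbit :=
  flatten (map enc_slit C) ++ const_bits tokEndC.
Definition enc_scnf (F : seq (seq (nat * sbit))) : seq sbit :=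
  flatten (map enc_sclause F) ++ const_bits tokEndF.
Definition enc_spk (s : seq sbit) (k : nat) : seq sbit :=
  flatten [seq [:: e; e] | e <- s] ++ const_bits ([:: false; true] ++ nseq k true).

Arguments enc_slit : simpl never.
Arguments enc_sclause : simpl never.
Arguments enc_lit : simpl never.
Arguments enc_clause : simpl never.

Definition ninst (tau : var -> bool) (F : seq (seq (nat * sbit))) : cnf :=
  [seq [seq (l.1, beval tau l.2) | l <- C] | C <- F].

Section EncSym.
Variable tau : var -> bool.
Local Notation ev := (map (beval tau)).

Lemma beval_const s : ev (const_bits s) = s.
Proof. by rewrite -map_comp -[RHS]map_id. Qed.

Lemma beval_neg e : beval tau (bneg e) = ~~ beval tau e.
Proof. by case: e => [//|[v s]] /=; case: (tau v); case: s. Qed.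

Lemma beval_slit l : ev (enc_slit l) = enc_lit (l.1, beval tau l.2).
Proof.
by rewrite /enc_slit map_cat beval_const /enc_lit /= beval_neg; case: (beval tau l.2).
Qed.

Lemma beval_sclause C : ev (enc_sclause C) = enc_clause [seq (l.1, beval tau l.2) | l <- C].
Proof.
rewrite /enc_sclause /enc_clause map_cat beval_const; congr (_ ++ _).
by rewrite map_flatten -!map_comp; congr flatten; apply: eq_map => a; apply: beval_slit.
Qed.

Lemma beval_scnf F : ev (enc_scnf F) = enc_cnf (ninst tau F).
Proof.
rewrite /enc_scnf /enc_cnf map_cat beval_const; congr (_ ++ _).
by rewrite map_flatten -!map_comp; congr flatten; apply: eq_map => a; apply: beval_sclause.
Qed.

Lemma beval_spk s k : ev (enc_spk s k) = enc_pk (ev s) k.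
Proof.
rewrite /enc_spk map_cat beval_const; congr (_ ++ _).
by elim: s => //= e s ->.
Qed.

End EncSym.

Definition outer_cnf (V : Type) (F : seq (seq (V * sbit))) : bool := all (all (fun l => outer_bit l.2)) F.

Lemma outer_const s : all outer_bit (const_bits s).
Proof. by rewrite all_map; apply/allP. Qed.

Lemma all_flatten (V : Type) (p : pred V) s : all p (flatten s) = all (all p) s.
Proof. by elim: s => //= x s IHs; rewrite all_cat IHs. Qed.

Lemma outer_scnf F : outer_cnf F -> all outer_bit (enc_scnf F).
Proof.
move=> /allP oF; rewrite all_cat outer_const andbT all_flatten all_map; apply/allP => C /oF/allP oC /=.
rewrite all_cat outer_const andbT all_flatten all_map; apply/allP => -[v e] /oC /= oe.
by rewrite /= oe outer_const !andbT; case: e oe => [|[]].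
Qed.

Lemma outer_spk s k : all outer_bit s -> all outer_bit (enc_spk s k).
Proof.
by move=> os; rewrite all_cat outer_const andbT; elim: s os => //= e s IHs /andP[-> /IHs].
Qed.

(** * The kernelization input as a symbolic string *)

Section Kernel_input.
Variables (M : TM) (T n P l : nat).

(** It is independent of the family of strings, so all families share the same numbering, backdoor
    and parameter. *)
Definition or_scope : seq var :=
  undup (vars (Phi M T n P) ++ map Yv (iota 0 n) ++ map Sv (iota 0 l)).

Definition or_sym : seq (seq (nat * sbit)) := rename or_scope (or_instance (Phi M T n P) l n).

Definition kernel_bits : seq sbit :=
  enc_spk (enc_scnf or_sym ++ const_bits (enc_vars (iota 0 (size or_scope)))) (size or_scope).

Lemma beval_kernel_bits tau : map (beval tau) kernel_bits =
  enc_pk (enc_instance (ninst tau or_sym) (iota 0 (size or_scope))) (size or_scope).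
Proof. by rewrite beval_spk map_cat beval_scnf beval_const. Qed.

Lemma ninst_or_sym tau :
  ninst tau or_sym = rename or_scope (inst tau (or_instance (Phi M T n P) l n)).
Proof.
rewrite /ninst /or_sym /rename /inst -!map_comp; apply: eq_map => C /=.
by rewrite -!map_comp.
Qed.

Lemma scoped_or tau : scoped or_scope (inst tau (or_instance (Phi M T n P) l n)).
Proof.
rewrite inst_cat inst_lift [scoped _ _]all_cat; apply/andP; split.
  by apply: scopedW (scoped_vars (Phi M T n P)) => v vP; rewrite mem_undup mem_cat vP.
apply/allP => _ /mapP[C /flattenP[_ /mapP[i _ ->] /mapP[j jn ->]] ->].
apply/allP => _ /mapP[a + ->]; rewrite mem_rcons inE => /orP[/eqP ->|/mapP[b bl ->]] /=.
  by rewrite mem_undup !mem_cat map_f ?orbT.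
by rewrite mem_undup !mem_cat [X in _ || (_ || X)]map_f ?orbT.
Qed.

Lemma outer_kernel_bits : all outer_bit kernel_bits.
Proof.
apply: outer_spk; rewrite all_cat outer_const andbT; apply: outer_scnf.
rewrite /outer_cnf /or_sym /rename all_map /or_instance all_cat; apply/andP; split.
  by apply/allP => _ /mapP[C _ ->]; rewrite /= all_map; apply/allP => _ /mapP[a _ ->].
apply/allP => _ /flattenP[_ /mapP[i _ ->] /mapP[j _ ->]] /=.
by rewrite all_map all_rcons /=; apply/allP => _ /mapP[b _ ->].
Qed.

Lemma kernel_inputP A tau : is_subsolver A ->
  SAT_backdoor A (enc_instance (ninst tau or_sym) (iota 0 (size or_scope))) (size or_scope) <->
  exists2 i, size i = l & exists2 w, size w <= P &
    tape_out (final_tape M T (pairS (mkseq (fun j => tau (Xv i j)) n) w)) = [:: true].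
Proof.
move=> sA; rewrite -[X in SAT_backdoor _ _ X](size_iota 0).
rewrite SAT_backdoorP ?iota_uniq // ninst_or_sym; last exact/scoped_rename/scoped_or.
by rewrite (satisfiable_rename (Yv 0) (scoped_or tau)); apply: or_instanceP.
Qed.

End Kernel_input.

(** * Non-membership as a CNF formula *)

Section NonMember.
Variables (M : TM) (T n l m : nat) (pre : seq sbit) (Z : seq (seq bool)).

Definition guess_clauses (i : seq bool) : gcnf var :=
  bigcat (iota 0 n) (fun j => [:: [:: (Gv i, false); (Iv j, false); (Xv i j, true)];
                                  [:: (Gv i, false); (Iv j, true); (Xv i j, false)]]).

(** The [Gv] clause guesses the place of the input in the family, the [Rv] clause the output in [Z].
    The run has no free cells, since [pre] is the whole input of the kernelization machine. *)
Definition Psi : gcnf var :=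
  run_clauses M T pre 0 m ++
  [:: [seq (Gv i, true) | i <- indices l]] ++ bigcat (indices l) guess_clauses ++
  [:: [seq (Rv z, true) | z <- Z]] ++ bigcat Z (fun z => output_clauses T [:: (Rv z, false)] z).

Lemma csat_Psi sigma : csat sigma Psi =
  [&& csat sigma (run_clauses M T pre 0 m),
      has (fun i => sigma (Gv i)) (indices l), all (fun i => csat sigma (guess_clauses i)) (indices l),
      has (fun z => sigma (Rv z)) Z & all (fun z => csat sigma (output_clauses T [:: (Rv z, false)] z)) Z].
Proof.
rewrite /Psi; move: (run_clauses _ _ _ _ _) => R.
rewrite !csat_cat !csat_bigcat !csat_cons !has_map /= !andbT.
by congr [&& _, _, _, _ & _]; apply: eq_has => i /=; rewrite eqb_id.
Qed.

Lemma Psi_sound sigma : csat sigma Psi -> all (fun z => size z <= m) Z ->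
  (exists2 i, size i = l & forall j, j < n -> sigma (Xv i j) = sigma (Iv j)) /\
  tape_out (final_tape M T (map (beval sigma) pre)) \in Z.
Proof.
rewrite csat_Psi => /and5P[/run_sound[w w0 cells] /hasP[i il gi] /allP gs /hasP[z zZ rz] /allP outs] /allP sZ.
split.
  exists i; first by apply/eqP; rewrite -mem_indices.
  move=> j jn; have := gs i il; rewrite csat_bigcat => /allP/(_ j); rewrite mem_iota0 => /(_ jn) /=.
  by rewrite gi /=; case: (sigma (Iv j)); case: (sigma (Xv i j)).
move: cells; case: w w0 => // _; rewrite cats0 => cells.
rewrite (output_sound (outs z zZ)) //; first by rewrite /= rz.
by move=> p pz; apply: cells; apply: leq_trans (sZ z zZ).
Qed.

Lemma Psi_complete tau i x : size i = l -> all outer_bit pre ->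
  (forall j, j < n -> tau (Xv i j) = tau (Iv j)) ->
  x = map (beval tau) pre -> tape_out (final_tape M T x) \in Z ->
  exists2 sigma, csat sigma Psi & forall j, sigma (Iv j) = tau (Iv j).
Proof.
move=> il opre hi xE zZ; set z := tape_out _ in zZ.
pose tau' (v : var) : bool := let: (k, _, _, s) := v in
  if k == 6 then s == i else if k == 7 then s == z else tau v.
exists (run_assign M T x tau'); last by [].
have xE' : x = map (beval tau') pre ++ [::].
  rewrite cats0 xE; apply/eq_in_map => -[//|[[[[k t] p] s] b]] /(allP opre) /=.
  by do 8![case: k => [|k] //].
rewrite csat_Psi; apply/and5P; split.
- exact: run_complete (leqnn _) opre xE'.
- by apply/hasP; exists i; rewrite ?mem_indices ?il //= eqxx.
- apply/allP => i' _; rewrite csat_bigcat; apply/allP => j; rewrite mem_iota0 => jn /=.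
  have [->|] //= := eqVneq i' i; rewrite hi //; by case: (tau _).
- by apply/hasP; exists z => //=; rewrite eqxx.
- apply/allP => z' _; apply: (@output_complete _ M T x).
    by move=> t p a; rewrite /= (inj_eq sym_code_inj).
  by have [->|ne] := eqVneq z' z; [right | left; rewrite /= (negPf ne)].
Qed.

End NonMember.

(** * Size bounds *)

(** The state clause weighs 4; each cell has three clauses of weight 5; the factor 3 counts the
    scanned symbols. *)
Lemma weight_tableau M T H U : weight (tableau M T H U) <= T * ((tm_n M).+1 * (3 * (4 + U * 15))).
Proof.
rewrite -[X in X * _](size_iota 0 T); apply: weight_flatten => t _.
rewrite -[X in X * _](card_ord (tm_n M).+1) cardE; apply: weight_flatten => q _.
apply: (@weight_flatten _ _ syms) => a _; rewrite /step_clauses.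
case: (full_delta q a) => [[q' s] m]; rewrite -cat1s weight_cat; apply: leq_add => //.
by rewrite -[X in X * _](size_iota 1 U); apply: weight_flatten => p _; rewrite (@weight_map _ _ _ _ 4).
Qed.

Lemma weight_input pre P H U :
  weight (input_clauses pre P H U) <= 2 + (H * 2 + (size pre * 6 + (P * 7 + (U + 1) * 2))).
Proof.
rewrite /input_clauses -cat1s !weight_cat; do !apply: leq_add => //.
- by rewrite -[X in X * _](size_iota 0 H); apply: weight_flatten.
- rewrite -[X in X * _](size_iota 0 (size pre)); apply: weight_flatten => i _.
  by case: (nth _ _ _) => [b|[v s]].
- by rewrite -[X in X * _](size_iota 0 P); apply: weight_flatten.
- by rewrite -[X in X * _](size_iota (H + size pre + P) (U + 1)); apply: weight_flatten.
Qed.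

Definition run_weight (S T N P m : nat) : nat :=
  2 + (T.+1 * 2 + (N * 6 + (P * 7 + (run_window T (N + P) m + 1) * 2))) +
  T * (S * (3 * (4 + run_window T (N + P) m * 15))).

Lemma weight_run M T pre P m :
  weight (run_clauses M T pre P m) <= run_weight (tm_n M).+1 T (size pre) P m.
Proof. by rewrite weight_cat leq_add ?weight_input ?weight_tableau. Qed.

Lemma weight_output T guard z :
  weight (output_clauses T guard z) <= (size z).+1 * (3 * (size guard).+2).
Proof.
rewrite -[X in X * _](size_iota 0 (size z).+1); apply: weight_flatten => p _.
rewrite (@weight_map _ _ _ _ (size guard).+1); last by move=> a; rewrite size_rcons.
by rewrite leq_mul // size_filter (leq_trans (count_size _ _)).
Qed.

Lemma weight_Phi M T n P : weight (Phi M T n P) <= run_weight (tm_n M).+1 T (2 * n + 2) P 1 + 12.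
Proof.
rewrite weight_cat -size_pair_bits; apply: leq_add (weight_run _ _ _ _ _) _.
exact: weight_output.
Qed.

Lemma weight_or F l n : weight (or_instance F l n) <= weight F + 2 ^ l * (n * l.+2).
Proof.
rewrite weight_cat; apply: leq_add.
  by rewrite /lift_cnf; elim: F => //= C F IHF; rewrite /weight /= size_map; move: IHF; rewrite /weight; lia.
rewrite -size_indices; apply: weight_flatten => i _.
rewrite (@weight_map _ _ _ _ l.+1) ?size_iota // => j.
by rewrite size_rcons size_map size_iota.
Qed.

Lemma weight_guess n i : weight (guess_clauses n i) <= n * 8.
Proof. by rewrite -[X in X * _](size_iota 0 n); apply: weight_flatten. Qed.

Lemma weight_Psi M T n l m pre Z : all (fun z => size z <= m) Z ->
  weight (Psi M T n l m pre Z) <=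
  run_weight (tm_n M).+1 T (size pre) 0 m + ((2 ^ l).+1 + (2 ^ l * (n * 8) + ((size Z).+1 + size Z * (m.+1 * 9)))).
Proof.
move=> /allP sZ; rewrite /Psi; have := weight_run M T pre 0 m; move: (run_clauses _ _ _ _ _) => R wR.
rewrite !weight_cat; apply: leq_add wR (leq_add _ (leq_add _ (leq_add _ _))).
- by rewrite /weight /= size_map size_indices addn0.
- by rewrite -size_indices; apply: weight_flatten => i _; apply: weight_guess.
- by rewrite /weight /= size_map addn0.
apply: weight_flatten => z /sZ zm; apply: leq_trans (weight_output _ _ _) _.
by rewrite leq_mul.
Qed.

Lemma size_bits_aux f n : size (bits_aux f n) <= f.
Proof. by elim: f n => //= f IHf [|n] //=; apply: IHf. Qed.

Lemma size_enc_nat v : size (enc_nat v) <= 3 * v + 3.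
Proof.
rewrite /enc_nat size_cat leq_add2r; apply: leq_trans (leq_mul (leqnn 3) (size_bits_aux v v)).
by rewrite -/(nat_bits v); elim: (nat_bits v) => //= b s IHs; rewrite size_cat mulnS leq_add //; case: b.
Qed.

Lemma size_enc_vars k : size (enc_vars (iota 0 k)) <= k * (3 * k + 3) + 3.
Proof.
rewrite /enc_vars size_cat leq_add2r.
suff H s : all (fun v => v <= k) s -> size (flatten (map enc_nat s)) <= size s * (3 * k + 3).
  by rewrite -{2}(size_iota 0 k) H //; apply/allP => v; rewrite mem_iota0 => /ltnW.
elim: s => //= v s IHs /andP[vk /IHs h].
rewrite size_cat mulSn; apply: leq_add h; apply: leq_trans (size_enc_nat v) _; lia.
Qed.

Lemma size_scnf (F : seq (seq (nat * sbit))) k : all (all (fun l => l.1 <= k)) F ->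
  size (enc_scnf F) <= weight F * (3 * k + 6) + 3.
Proof.
move=> bF; rewrite /enc_scnf size_cat leq_add2r.
elim: F bF => //= C F IHF /andP[bC /IHF h]; rewrite size_cat /weight /= mulnDl leq_add //.
rewrite /enc_sclause size_cat mulSnr leq_add //; last by rewrite size_map /=; lia.
elim: C bC => //= l C IHC /andP[bl /IHC hC]; rewrite size_cat size_map mulSn.
have := size_enc_nat l.1; lia.
Qed.

Lemma rename_bounded (V : eqType) (B : Type) (vs : seq V) (F : seq (seq (V * B))) :
  all (all (fun l => l.1 <= size vs)) (rename vs F).
Proof.
elim: F => //= C F ->; rewrite andbT.
by elim: C => //= l C ->; rewrite index_size.
Qed.

Lemma weight_rename (V : eqType) (B : Type) (vs : seq V) (F : seq (seq (V * B))) :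
  weight (rename vs F) = weight F.
Proof. by elim: F => //= C F IHF; rewrite /weight /= size_map; congr (_ + _). Qed.

Lemma size_vars (V B : Type) (F : seq (seq (V * B))) : size (vars F) <= weight F.
Proof. by rewrite size_map size_flatten_weight. Qed.

Lemma size_or_scope M T n P l : size (or_scope M T n P l) <= weight (Phi M T n P) + n + l.
Proof.
apply: leq_trans (size_undup _) _; rewrite !size_cat !size_map !size_iota addnA.
by rewrite !leq_add2r size_flatten_weight.
Qed.

Definition kernel_size (w n l k : nat) : nat :=
  2 * ((w + 2 ^ l * (n * l.+2)) * (3 * k + 6) + 3 + (k * (3 * k + 3) + 3)) + 2 + k.

Lemma size_kernel_bits M T n P l k : size (or_scope M T n P l) <= k ->
  size (kernel_bits M T n P l) <= kernel_size (weight (Phi M T n P)) n l k.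
Proof.
move=> hk; have sdbl (s : seq sbit) : size (flatten [seq [:: e; e] | e <- s]) = 2 * size s.
  by elim: s => //= e s ->; rewrite mulnS.
rewrite /kernel_bits /enc_spk size_cat sdbl size_map size_cat size_map.
have h1 := size_scnf (rename_bounded (or_scope M T n P l) (or_instance (Phi M T n P) l n)).
rewrite weight_rename -/(or_sym _ _ _ _ _) in h1.
have h2 := weight_or (Phi M T n P) l n; have h3 := size_enc_vars (size (or_scope M T n P l)).
have h4 : size (enc_scnf (or_sym M T n P l)) <= (weight (Phi M T n P) + 2 ^ l * (n * l.+2)) * (3 * k + 6) + 3.
  by apply: leq_trans h1 _; rewrite leq_add2r; apply: leq_mul h2 _; rewrite leq_add2r leq_mul.
have h5 : size (enc_vars (iota 0 (size (or_scope M T n P l)))) <= k * (3 * k + 3) + 3.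
  apply: leq_trans h3 _; rewrite leq_add2r.
  have mono a b : a <= b -> a * (3 * a + 3) <= b * (3 * b + 3) by move=> ab; rewrite leq_mul; lia.
  exact: mono.
rewrite /kernel_size size_cat size_nseq -[_ + 2 + k]addnA; apply: leq_add; last by rewrite leq_add2l.
by rewrite leq_mul // leq_add.
Qed.

Lemma size_cnf_prog F N : all (all (fun l : literal => l.1 <= N)) F ->
  size (cnf_prog F) <= weight F * (2 * N + 3).
Proof.
elim: F => //= C F IHF /andP[bC /IHF h]; rewrite /cnf_prog /= size_cat /weight /= mulnDl leq_add //.
rewrite /clause_prog size_cat /= mulSnr leq_add //; last by lia.
elim: C bC => //= l C IHC /andP[bl /IHC hC]; rewrite !size_cat !size_nseq mulSn /= size_nseq.
by move: hC bl; rewrite /lit_prog; lia.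
Qed.

Lemma size_input_prog vx N : all (fun v => v <= N) vx -> size (input_prog vx) <= size vx * (2 * N + 5).
Proof.
elim: vx => //= v vx IHv /andP[bv /IHv h].
rewrite /input_prog /= -/(input_prog vx) !size_cat !size_nseq mulSn /= size_nseq.
by move: h bv; rewrite /visit; lia.
Qed.

Lemma size_eval_prog vx F N : all (fun v => v <= N) vx -> all (all (fun l : literal => l.1 <= N)) F ->
  size (eval_prog vx F) <= 4 + size vx * (2 * N + 5) + weight F * (2 * N + 3).
Proof.
move=> bv /size_cnf_prog bF; rewrite /eval_prog /= !size_cat /=.
have := @size_input_prog (rev vx) N; rewrite all_rev size_rev => /(_ bv); lia.
Qed.

Lemma leq_exp_base m n d : m <= n -> m ^ d <= n ^ d.
Proof. by case: d => // d; rewrite leq_exp2r. Qed.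

Lemma size_pairS x w : size (pairS x w) = 2 * size x + 2 + size w.
Proof. by rewrite /pairS !size_cat size_double addnA. Qed.

Lemma size_enc_pk x k : size (enc_pk x k) = 2 * size x + 2 + k.
Proof. by rewrite /enc_pk !size_cat size_double size_nseq addnA. Qed.

Lemma csat_eq (V : eqType) (vs : seq V) (sigma1 sigma2 : V -> bool) F :
  scoped vs F -> {in vs, sigma1 =1 sigma2} -> csat sigma1 F = csat sigma2 F.
Proof.
move=> /allP sF e; apply: eq_in_all => C /sF/allP sC.
by apply: eq_in_has => l /sC lv; rewrite e.
Qed.

Lemma card_bseq_bool m : #|{: m.-bseq bool}| <= 2 ^ m.+1.
Proof.
rewrite card_bseq card_bool; elim: m => [|m IHm]; first by rewrite big_ord1.
by rewrite big_ord_recr [2 ^ m.+2]expnS mul2n -addnn leq_add2r.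
Qed.

(** * Construction of the advice *)

Section Advice.
Variables (A : cnf -> answer) (L V : language) (f : seq bool -> seq bool) (MV : TM) (cV dV c0 d0 : nat).
Variables (K : seq bool -> nat -> seq bool * nat) (fK : seq bool -> seq bool) (MK : TM) (cK dK cg dg C : nat).
Hypotheses (sA : is_subsolver A) (compV : computes_in MV f (fun n => cV * n ^ dV + cV)).
Hypothesis decV : forall x, V x <-> f x = [:: true].
Hypothesis defL : forall x, L x <-> exists w, size w <= c0 * size x ^ d0 + c0 /\ V (pairS x w).
Hypothesis compK : computes_in MK fK (fun n => cK * n ^ dK + cK).
Hypothesis fKE : forall x k, fK (enc_pk x k) = enc_pk (K x k).1 (K x k).2.
Hypothesis kerK : forall x k, SAT_backdoor A x k <-> SAT_backdoor A (K x k).1 (K x k).2.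
Hypothesis szK : forall x k, size (K x k).1 + (K x k).2 <= cg * k ^ dg + cg.
Hypothesis expC : forall q, 2 * (cg * (2 * q + C) ^ dg + cg) + 3 <= 2 ^ (q + C).

Definition wit_len n := c0 * n ^ d0 + c0.
Definition ver_time n := cV * (2 * n + 2 + wit_len n) ^ dV + cV.
Definition ver_cnf n := Phi MV (ver_time n) n (wit_len n).
Definition ver_weight n := weight (ver_cnf n) + n.
Definition out_len n := 2 * (cg * (2 * ver_weight n + C) ^ dg + cg) + 2.
(** The least [l] with [2 ^ l] above [out_len n], so that the number of possible outputs is at most
    2 to the number of indices, as [halving] requires. *)
Definition sel_len n := up_log 2 (out_len n).+1.
Definition scope n := or_scope MV (ver_time n) n (wit_len n) (sel_len n).
Definition kin n := kernel_bits MV (ver_time n) n (wit_len n) (sel_len n).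
Definition ker_time n := cK * size (kin n) ^ dK + cK.

(** [out_len] anticipates this bound in its estimate of the number of variables; the choice of [C]
    makes the two consistent. *)
Lemma sel_len_bound n : sel_len n <= ver_weight n + C.
Proof. by apply: up_log_min => //; apply: leq_trans (expC _); rewrite /out_len; lia. Qed.

Lemma scope_bound n : size (scope n) <= 2 * ver_weight n + C.
Proof.
apply: leq_trans (size_or_scope _ _ _ _ _) _.
by have := sel_len_bound n; rewrite /ver_weight /ver_cnf; lia.
Qed.

Lemma ver_accepts n x w : size x = n -> size w <= wit_len n ->
  tape_out (final_tape MV (ver_time n) (pairS x w)) = [:: true] <-> V (pairS x w).
Proof.
move=> sx sw; rewrite decV (computes_final compV) // leq_add2r leq_mul //.
by rewrite leq_exp_base // size_pairS sx leq_add2l.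
Qed.

(** Whether the output is a yes-instance depends on the output alone, so of two families with the
    same output, both or neither contain a member of [L]. *)
Lemma kernel_spec n tau : exists x k,
  [/\ tape_out (final_tape MK (ker_time n) (map (beval tau) (kin n))) = enc_pk x k,
      size (enc_pk x k) <= out_len n
    & SAT_backdoor A x k <->
      exists2 i, size i = sel_len n & L (mkseq (fun j => tau (Xv i j)) n)].
Proof.
rewrite (computes_final compK) ?size_map // beval_kernel_bits fKE.
set F := enc_instance _ _; set k := size _; exists (K F k).1, (K F k).2; split=> //.
  rewrite size_enc_pk; have := szK F k.
  have : k ^ dg <= (2 * ver_weight n + C) ^ dg by apply/leq_exp_base/scope_bound.
  by move=> /(leq_mul (leqnn cg)); rewrite /out_len; lia.
rewrite -kerK kernel_inputP //; split=> -[i il].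
  by case=> w sw /ver_accepts; rewrite size_mkseq => /(_ erefl sw) Vw; exists i => //; apply/defL; exists w; rewrite size_mkseq.
move/defL => [w]; rewrite size_mkseq => -[sw Vw]; exists i => //; exists w => //.
by apply/ver_accepts; rewrite ?size_mkseq.
Qed.

(** Strings of the wrong length are read as the all-false index. *)
Definition tau_of n (X : {ffun (sel_len n).-tuple bool -> n.-tuple bool}) (v : var) : bool :=
  let: (_, j, _, i) := v in nth false (X (insubd [tuple of nseq (sel_len n) false] i)) j.

Lemma tau_ofE n (X : {ffun (sel_len n).-tuple bool -> n.-tuple bool}) i :
  mkseq (fun j => tau_of X (Xv (val i) j)) n = X i.
Proof.
have e : mkseq (nth false (X i)) n = X i by rewrite -[n in mkseq _ n](size_tuple (X i)) mkseq_nth.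
by rewrite -[RHS]e; apply: eq_mkseq => j /=; rewrite valKd.
Qed.

(** [value_cover] is applied to the non-members. Each value in [Z] is the output of a family of
    non-members, hence a no-instance, so no family containing a member of [L] is sent into [Z]. *)
Lemma kernel_cover n : exists Z : seq (seq bool),
  [/\ size Z <= n.+1, all (fun z => size z <= out_len n) Z &
    forall x, size x = n ->
      (~ L x -> exists tau, (exists2 i, size i = sel_len n & mkseq (fun j => tau (Xv i j)) n = x) /\
         tape_out (final_tape MK (ker_time n) (map (beval tau) (kin n))) \in Z) /\
      (L x -> forall tau i, size i = sel_len n -> mkseq (fun j => tau (Xv i j)) n = x ->
         tape_out (final_tape MK (ker_time n) (map (beval tau) (kin n))) \notin Z)].
Proof.
pose out tau := tape_out (final_tape MK (ker_time n) (map (beval tau) (kin n))).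
have out_le tau : size (out tau) <= out_len n.
  by have [x [k [e h _]]] := kernel_spec n tau; rewrite /out e.
pose h (X : {ffun (sel_len n).-tuple bool -> n.-tuple bool}) : (out_len n).-bseq bool := Bseq (out_le (tau_of X)).
pose N := [set x : n.-tuple bool | if excluded_middle_informative (L x) then false else true].
have I0 : 0 < #|{: (sel_len n).-tuple bool}| by rewrite card_tuple card_bool expn_gt0.
have WI : #|{: (out_len n).-bseq bool}| <= 2 ^ #|{: (sel_len n).-tuple bool}|.
  apply: leq_trans (card_bseq_bool _) _; rewrite card_tuple card_bool leq_exp2l //.
  exact: up_logP.
have cN : #|N| < 2 ^ n.+1.
  apply: leq_ltn_trans (max_card _) _; rewrite card_tuple card_bool ltn_exp2l //.
have [Z [sZ covZ realZ]] := value_cover h I0 WI cN.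
exists (map val Z); split; first by rewrite size_map.
  by apply/allP => _ /mapP[z _ ->]; apply: size_bseq.
move=> x /eqP sx; split=> [nLx|Lx tau i il Xi].
  have [|X hX [i Xi]] := covZ (Tuple sx); first by rewrite inE; case: excluded_middle_informative.
  exists (tau_of X); split; last by apply/mapP; exists (h X).
  by exists (val i); [rewrite size_tuple | rewrite tau_ofE Xi].
apply/mapP => -[z /realZ[X hX XN] e].
have [y [k [e1 _ sat1]]] := kernel_spec n tau.
have [y' [k' [e2 _ sat2]]] := kernel_spec n (tau_of X).
have [ey ek] : y = y' /\ k = k' by apply: enc_pk_inj; rewrite -e1 -e2 e -hX.
have [i' il' Li'] : exists2 i', size i' = sel_len n & L (mkseq (fun j => tau_of X (Xv i' j)) n).
  by apply/sat2; rewrite -ey -ek; apply/sat1; exists i => //; rewrite Xi.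
have := XN (Tuple (introT eqP il')); rewrite inE; case: excluded_middle_informative => // nL _.
by case: nL; rewrite -tau_ofE.
Qed.

Definition psi_weight n := run_weight (tm_n MK).+1 (ker_time n) (size (kin n)) 0 (out_len n) +
  ((2 ^ sel_len n).+1 + (2 ^ sel_len n * (n * 8) + (n.+2 + n.+1 * ((out_len n).+1 * 9)))).
Definition psi_scope n := n + psi_weight n.
Definition advice_len n := 2 * (3 * (4 + n * (2 * psi_scope n + 5) + psi_weight n * (2 * psi_scope n + 3))).

Lemma advice_exists n : exists a, size a <= advice_len n /\
  forall x, size x = n ->
    (~ L x -> exists w, size w <= psi_scope n /\ run_spec (pairS (pairS x a) w)) /\
    (forall w, run_spec (pairS (pairS x a) w) -> ~ L x).
Proof.
have [Z [sZ bZ specZ]] := kernel_cover n.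
pose F := Psi MK (ker_time n) n (sel_len n) (out_len n) (kin n) Z.
have wF : weight F <= psi_weight n.
  apply: leq_trans (weight_Psi _ _ _ _ _ bZ) _; rewrite leq_add2l !leq_add2l leq_add //.
  by rewrite leq_mul.
(* The input variables are always listed, since the program compares them with [x]. *)
pose vs := undup (map Iv (iota 0 n) ++ vars F).
have svs : size vs <= psi_scope n.
  apply: leq_trans (size_undup _) _; rewrite size_cat size_map size_iota leq_add2l.
  exact: leq_trans (size_vars F) wF.
have scF : scoped vs F.
  by apply: scopedW (scoped_vars F) => v vF; rewrite mem_undup mem_cat vF orbT.
pose vx := [seq index (Iv j) vs | j <- iota 0 n].
exists (enc_prog (eval_prog vx (rename vs F))); split.
  rewrite size_enc_prog /advice_len; apply: (@leq_trans (3 * (4 + n * (2 * psi_scope n + 5) + psi_weight n * (2 * psi_scope n + 3)))); last by lia.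
  rewrite leq_mul //; apply: leq_trans (@size_eval_prog _ _ (psi_scope n) _ _) _.
  - by rewrite all_map; apply/allP => j _ /=; apply: leq_trans (index_size _ _) svs.
  - apply: sub_all (rename_bounded vs F) => c; apply: sub_all => l lv; exact: leq_trans lv svs.
  - by rewrite size_map size_iota weight_rename leq_add2l leq_mul.
move=> x sx; have svx : size vx = size x by rewrite size_map size_iota sx.
have [specN specY] := specZ x sx; split=> [nLx|w].
  have [tau [[i il Xi] outZ]] := specN nLx.
  (* Setting the input variables to [x] leaves the kernel input unchanged, as its literals have
     kinds 2 to 4. *)
  pose tau' (v : var) : bool := if v.1.1.1 == 5 then nth false x v.1.1.2 else tau v.
  have e' : map (beval tau) (kin n) = map (beval tau') (kin n).
    apply/eq_in_map => -[//|[[[[k t] p] s] b]] /(allP (outer_kernel_bits _ _ _ _ _)).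
    by do 6![case: k => [|k] //].
  have [|sigma sF sI] := @Psi_complete MK (ker_time n) n (sel_len n) (out_len n) (kin n) Z tau' i _ il (outer_kernel_bits _ _ _ _ _) _ e' outZ.
    move=> j jn; rewrite /tau' /= -Xi nth_mkseq //.
  exists (map sigma vs); rewrite size_map; split=> //.
  have nthE v : v \in vs -> nth false (map sigma vs) (index v vs) = sigma v.
    by move=> vv; rewrite (nth_map (Yv 0)) ?index_mem // nth_index.
  rewrite run_eval_prog //; apply/andP; split; last first.
    rewrite csat_rename (csat_eq scF (sigma2 := sigma)) // => v; exact: nthE.
  apply/eqP; apply: (@eq_from_nth _ false); rewrite !size_map size_iota ?sx // => j jn.
  rewrite -map_comp (nth_map 0) ?size_iota // nth_iota // add0n /= nthE ?sI //.
  by rewrite mem_undup mem_cat map_f // mem_iota0.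
rewrite run_eval_prog // csat_rename => /andP[/eqP xE sF] Lx.
have [[i il Xi] outZ] := Psi_sound sF bZ.
suff /(specY Lx (fun v => nth false w (index v vs)) i il) : mkseq (fun j => nth false w (index (Xv i j) vs)) n = x by rewrite outZ.
rewrite -[RHS]xE /vx -map_comp; apply/eq_in_map => j; rewrite mem_iota0 => jn.
exact: Xi.
Qed.

(** * Polynomial length of advice and guesses *)

Ltac poly := rewrite /kernel_size /run_weight /run_window; repeat
  match goal with
  | h : polyb ?f |- polyb ?f => exact: h
  | h : polyb ?f |- polyb (fun n => ?f n) => exact: h
  | |- polyb (fun n => n) => exact: polyb_id
  | |- polyb (fun _ => ?c) => exact: polyb_const
  | |- polyb (fun n => S (@?f n)) => apply: polyb_S
  | |- polyb (fun n => addn (@?f n) (@?g n)) => apply: polyb_add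
  | |- polyb (fun n => muln (@?f n) (@?g n)) => apply: polyb_mul
  | |- polyb succn => exact: polyb_S polyb_id
  | |- polyb (muln ?c) => exact: polyb_mul (polyb_const c) polyb_id
  | |- polyb (fun n => expn (@?f n) ?d) => apply: polyb_exp
  end.

Lemma polyb_ver_weight : polyb ver_weight.
Proof.
apply: (@polyb_le _ (fun n => run_weight (tm_n MV).+1 (ver_time n) (2 * n + 2) (wit_len n) 1 + 12 + n)).
  by move=> n; rewrite leq_add2r weight_Phi.
rewrite /ver_time /wit_len; poly.
Qed.

Lemma polyb_out_len : polyb out_len.
Proof. by have pw := polyb_ver_weight; rewrite /out_len; poly. Qed.

(** Minimality of [up_log] bounds the power by twice [(out_len n).+1]. *)
Lemma polyb_exp_sel_len : polyb (fun n => 2 ^ sel_len n).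
Proof.
have po := polyb_out_len; apply: (@polyb_le _ (fun n => 2 * (out_len n).+1)); last by poly.
move=> n; have o1 : 1 < (out_len n).+1 by rewrite /out_len; lia.
have := up_log_bounds (ltnSn 1) o1; rewrite /sel_len /=.
have : 0 < up_log 2 (out_len n).+1 by rewrite up_log_gt0 o1.
by case: up_log => //= k _; rewrite [2 ^ k.+1]expnS; lia.
Qed.

Lemma polyb_kin : polyb (fun n => size (kin n)).
Proof.
have pw := polyb_ver_weight; have ps := polyb_exp_sel_len.
have pl : polyb sel_len by apply: polyb_le sel_len_bound _; poly.
apply: (@polyb_le _ (fun n => kernel_size (ver_weight n) n (sel_len n) (2 * ver_weight n + C))); last by poly.
move=> n; apply: leq_trans (size_kernel_bits (scope_bound n)) _.
by rewrite /kernel_size !(leq_add2r, leq_add2l, leq_mul) // leq_addr.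
Qed.

Lemma polyb_psi_weight : polyb psi_weight.
Proof.
have po := polyb_out_len; have ps := polyb_exp_sel_len; have pk := polyb_kin.
by rewrite /psi_weight /ker_time; poly.
Qed.

Lemma polyb_psi_scope : polyb psi_scope.
Proof. by have pw := polyb_psi_weight; rewrite /psi_scope; poly. Qed.

Lemma polyb_advice_len : polyb advice_len.
Proof. by have pw := polyb_psi_weight; have ps := polyb_psi_scope; rewrite /advice_len; poly. Qed.

Lemma co_nondeterministic_advice : in_coNP_poly L.
Proof.
have [c1 [d1 b1]] := polyb_bound polyb_psi_scope.
have [c2 [d2 b2]] := polyb_bound polyb_advice_len.
have [alpha alphaP] : {alpha : nat -> seq bool | forall n, size (alpha n) <= advice_len n /\
  forall x, size x = n ->
    (~ L x -> exists w, size w <= psi_scope n /\ run_spec (pairS (pairS x (alpha n)) w)) /\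
    (forall w, run_spec (pairS (pairS x (alpha n)) w) -> ~ L x)}.
  exists (fun n => proj1_sig (constructive_indefinite_description _ (advice_exists n))) => n.
  exact: proj2_sig (constructive_indefinite_description _ (advice_exists n)).
(* The coNP language is the same evaluation problem for every [L], up to the bound on the guess: no
   guess makes the given program accept. *)
exists (fun y => ~ exists w, size w <= c1 * size y ^ d1 + c1 /\ run_spec (pairS y w)), alpha, c2, d2.
split; last split.
- exists run_spec, c1, d1; split; first exact: run_spec_decidable.
  by move=> y; split=> [/NNPP|h] //; apply.
- by move=> n; have [h _] := alphaP n; apply: leq_trans h (b2 n).
move=> x; have [_ /(_ x erefl)[hN hY]] := alphaP (size x); split=> [Lx [w [_ /hY]]|h] //.
apply: NNPP => /hN[w [sw rw]]; case: h; exists w; split=> //.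
apply: leq_trans sw (leq_trans (b1 _) _); rewrite leq_add2r leq_mul // leq_exp_base //.
by rewrite size_pairS; lia.
Qed.

End Advice.

Theorem theorem4 (A : cnf -> answer) :
  is_subsolver A -> has_poly_kernel (SAT_backdoor A) -> NP_subset_coNP_poly.
Proof.
move=> sA [K [cg [dg [[fK [[MK [cK [dK compK]]] fKE]] [kerK szK]]]]] L.
move=> [V [c0 [d0 [[f [[MV [cV [dV compV]]] decV]] defL]]]].
have [C expC] := poly_leq_exp_shift cg dg.
exact: co_nondeterministic_advice sA compV decV defL compK fKE kerK szK expC.
Qed.
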